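(* Let $\varphi$ be a state on $\mathbb{C}\langle x_1,\ldots,x_d\rangle$ with a monic orthogonal polynomial system (MOPS), zero means and identity covariance. Let $R$ and $\eta$ be its free and Boolean cumulant generating functions. The following conditions (B1), (B2) are equivalent to each other and to each of the (mutually equivalent) conditions (F1)–(F4) characterizing $\varphi$ as a free Meixner state. (B1) The polynomials $P_{\vec u}$ with the generating function $$\sum_{|\vec u|\ge0}P_{\vec u}(\mathbf{x})z_{\vec u}=\bigl(1-\mathbf{x}\cdot\mathbf{V}(\mathbf{z})\bigr)^{-1}\bigl(1-\eta(\mathbf{V}(\mathbf{z}))\bigr)$$ are a MOPS for $\varphi$, where $(D_i\eta)(\mathbf{V}(\mathbf{z}))=z_i$ for each $i$, so that $\mathbf{V}=(\mathbf{D}\eta)^{\langle-1\rangle}$. (B2) For some admissible data $(C,\{T_i\})$, the Boolean cumulant generating function satisfies, for each $i,j$, $$D_iD_j\eta(\mathbf{w})=\delta_{ij}+\sum_{k=1}^dB_{ij}^kD_k\eta(\mathbf{w})+(1+C_{ij})\,D_i\eta(\mathbf{w})\,D_j\eta(\mathbf{w}),\qquad B_{ij}^k=(T_i)_{jk}.$$ (F1) For some $d$-tuple $\mathbf{U}$ of non-commutative power series with zero constant term, the polynomials with generating function $\sum_{|\vec u|\ge0}P_{\vec u}(\mathbf{x})z_{\vec u}=\bigl(1-\mathbf{x}\cdot\mathbf{U}(\mathbf{z})+R(\mathbf{U}(\mathbf{z}))\bigr)^{-1}$ are a MOPS for $\varphi$. (F2) For some admissible data $(C,\{T_i\})$, $\varphi=\varphi_{C,\{T_i\}}$,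 i.e. $\varphi[P(x_1,\ldots,x_d)]=\langle\Omega,P(\mathcal{X}_1,\ldots,\mathcal{X}_d)\Omega\rangle$ for all $P$, with the Fock space operators $\mathcal{X}_i$ defined from $(C,\{T_i\})$. (F3) For some admissible data $(C,\{T_i\})$, for each $i,j$, $$D_iD_jR(\mathbf{z})=\delta_{ij}+\sum_{k=1}^dB_{ij}^kD_kR(\mathbf{z})+C_{ij}\,D_iR(\mathbf{z})\,D_jR(\mathbf{z}),\qquad B_{ij}^k=(T_i)_{jk}.$$ (F4) For some admissible data $(C,\{T_i\})$, there is a family of polynomials $\{P_{\vec u}\}$, $P_\emptyset=1$, with $\varphi[P_{\vec u}]=0$ for all $\vec u\ne\emptyset$ and $$x_i=P_i,\qquad x_iP_j=P_{(i,j)}+\sum_{k=1}^d(T_i)_{kj}P_k+\delta_{ij},$$ $$x_iP_{(j,\vec u)}=P_{(i,j,\vec u)}+\sum_{k=1}^d(T_i)_{kj}P_{(k,\vec u)}+\delta_{ij}(1+C_{i,u(1)})P_{\vec u}\quad(|\vec u|\ge1).$$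
   Context: $\mathbb{C}\langle\mathbf{x}\rangle=\mathbb{C}\langle x_1,\ldots,x_d\rangle$: polynomials in non-commuting self-adjoint variables; multi-indices $\vec u\in\{1,\ldots,d\}^n$, $|\vec u|=n$, $x_{\vec u}=x_{u(1)}\cdots x_{u(n)}$. A state is a unital linear functional with $\varphi[P^*]=\overline{\varphi[P]}$, $\varphi[P^*P]\ge0$. Zero means and identity covariance: $\varphi[x_i]=0$, $\varphi[x_ix_j]=\delta_{ij}$. A MOPS for $\varphi$ is a family $\{P_{\vec u}\}$ with $P_{\vec u}=x_{\vec u}+$ lower-order terms, $P_\emptyset=1$, and $\varphi[P_{\vec u}^*P_{\vec v}]=0$ for $\vec u\ne\vec v$. Power series are in non-commuting indeterminates $\mathbf{z}$ (or $\mathbf{w}$), which commute with the $x_i$; $\mathbf{x}\cdot\mathbf{V}=\sum_ix_iV_i$; $(\cdot)^{-1}$ is the multiplicative inverse, and $(\cdot)^{\langle-1\rangle}$ the compositional inverse of a $d$-tuple. $D_i$ is the linear operator on power series with $D_i1=0$, $D_iz_{\vec u}=\delta_{i,u(1)}z_{u(2)}\cdots z_{u(n)}$; $\mathbf{D}G=(D_1G,\ldots,D_dG)$. Boolean (resp. free) cumulants: the linear functional $\eta$ (resp. $R$) vanishing on $1$ with $\varphi[x_{\vec u}]=\sum_\pi\prod_{B\in\pi}\eta[\prod_{i\in B}x_{u(i)}]$ over interval partitions (resp. the same with $R$ over non-crossing partitions) of $\{1,\ldots,|\vec u|\}$; $\eta(\mathbf{z})=\sum_{|\vec u|\ge1}\eta[x_{\vec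 u}]z_{\vec u}$, $R(\mathbf{z})=\sum_{|\vec u|\ge1}R[x_{\vec u}]z_{\vec u}$. Admissible data $(C,\{T_i\})$: Hermitian $d\times d$ matrices $T_1,\ldots,T_d$ and a diagonal $d^2\times d^2$ matrix $C$, $C(e_i\otimes e_j)=C_{ij}\,e_i\otimes e_j$, with $I+C\ge0$ and $(T_i\otimes I)C=C(T_i\otimes I)$ for all $i$. On the algebraic full Fock space $\mathbb{C}\Omega\oplus\bigoplus_{k\ge1}(\mathbb{C}^d)^{\otimes k}$, the operators in (F2) are: $\mathcal{X}_i\Omega=e_i$, $\mathcal{X}_ie_j=e_i\otimes e_j+T_ie_j+\delta_{ij}\Omega$, and $\mathcal{X}_i(e_j\otimes e_k\otimes\xi)=e_i\otimes e_j\otimes e_k\otimes\xi+(T_ie_j)\otimes e_k\otimes\xi+\delta_{ij}(1+C_{jk})\,e_k\otimes\xi$; $\langle\Omega,\cdot\,\rangle$ is the coefficient of $\Omega$. *)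

(* Defs.v *)
From HB Require Import structures.
From mathcomp Require Import all_boot all_order all_algebra.
From mathcomp Require Import sesquilinear spectral.
From mathcomp Require Export finmap monalg mxtens complex.
From mathcomp Require Import boolp reals.

Set Implicit Arguments.
Unset Strict Implicit.
Unset Printing Implicit Defensive.

Import Order.TTheory GRing.Theory Num.Theory.
Local Open Scope ring_scope.

(* Formal power series in non-commuting indeterminates z_1, ..., z_d with
   coefficients in A, the z_i commuting with A: the coercion [pscoef] gives the
   coefficient f u of z_u = z_(u 1) ... z_(u n), for u a word. *)
Record ncps (d : nat) (A : Type) := NCPS { pscoef :> seq 'I_d -> A }.

Lemma ncpsP d A (f g : ncps d A) : f = g <-> (f : _ -> _) =1 g.
Proof.
by split=> [-> //|]; case: f g => [f] [g] /= /funext ->.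
Qed.

Section SeriesRing.
Variables (d : nat) (A : nzRingType).
Implicit Types (f g h : ncps d A) (u v : seq 'I_d).

HB.instance Definition _ := [isNew for @pscoef d A].
HB.instance Definition _ := [Choice of ncps d A by <:].

Definition psadd f g : ncps d A := NCPS (fun u => f u + g u).
Definition psopp f : ncps d A := NCPS (fun u => - f u).
Definition psC (a : A) : ncps d A := NCPS (fun u => a *+ (u == [::])).
Definition psmul f g : ncps d A :=
  NCPS (fun u => \sum_(k < (size u).+1) f (take k u) * g (drop k u)).
Definition psD (i : 'I_d) f : ncps d A := NCPS (fun u => f (i :: u)).
Definition psX (i : 'I_d) : ncps d A := NCPS (fun u => (u == [:: i])%:R).

Fact psaddE f g u : psadd f g u = f u + g u. Proof. by []. Qed.
Fact psaddA : associative psadd.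
Proof. by move=> f g h; apply/ncpsP => u /=; rewrite addrA. Qed.
Fact psaddC : commutative psadd.
Proof. by move=> f g; apply/ncpsP => u /=; rewrite addrC. Qed.
Fact psadd0 : left_id (psC 0) psadd.
Proof. by move=> f; apply/ncpsP => u /=; rewrite mul0rn add0r. Qed.
Fact psaddN : left_inverse (psC 0) psopp psadd.
Proof. by move=> f; apply/ncpsP => u /=; rewrite mul0rn addNr. Qed.

HB.instance Definition _ :=
  GRing.isZmodule.Build (ncps d A) psaddA psaddC psadd0 psaddN.

Fact psmul_nil f g : psmul f g [::] = f [::] * g [::].
Proof. by rewrite /= big_ord1. Qed.

Fact psmul_cons f g i u :
  psmul f g (i :: u) = f [::] * g (i :: u) + psmul (psD i f) g u.
Proof. by rewrite /= big_ord_recl. Qed.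

Fact psmulDl : left_distributive psmul psadd.
Proof.
move=> f g h; apply/ncpsP => u /=.
by rewrite -big_split; apply: eq_bigr => k _; rewrite mulrDl.
Qed.

Fact psmulDr : right_distributive psmul psadd.
Proof.
move=> f g h; apply/ncpsP => u /=.
by rewrite -big_split; apply: eq_bigr => k _; rewrite mulrDr.
Qed.

Fact psmulCl a f u : psmul (psC a) f u = a * f u.
Proof.
case: u => [|i u]; rewrite ?psmul_nil ?psmul_cons //= big1 ?addr0 // => k _.
by rewrite mul0r.
Qed.

Fact psD_mul i f g :
  psD i (psmul f g) = psadd (psmul (psC (f [::])) (psD i g)) (psmul (psD i f) g).
Proof.
by apply/ncpsP => u; rewrite psaddE psmulCl; apply: psmul_cons.
Qed.

Fact psmulA : associative psmul.
Proof.
move=> f g h; apply/ncpsP => u; elim: u f g h => [|i u IHu] f g h.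
  by rewrite !psmul_nil mulrA.
rewrite 3!psmul_cons psmul_nil psD_mul psmulDl mulrDr mulrA -addrA.
by congr (_ + _); rewrite psaddE -!IHu psmulCl.
Qed.

Fact psmul1 : left_id (psC 1) psmul.
Proof. by move=> f; apply/ncpsP => u; rewrite psmulCl mul1r. Qed.

Fact psmulr1 : right_id (psC 1) psmul.
Proof.
move=> f; apply/ncpsP => u; elim: u f => [|i u IHu] f.
  by rewrite psmul_nil /= mulr1.
by rewrite psmul_cons IHu /= mulr0 add0r.
Qed.

Fact psC1_neq0 : psC 1 != psC 0.
Proof. by apply/eqP => /ncpsP/(_ [::])/eqP; rewrite /= oner_eq0. Qed.

HB.instance Definition _ := GRing.Zmodule_isNzRing.Build (ncps d A)
  psmulA psmul1 psmulr1 psmulDl psmulDr psC1_neq0.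

Lemma pscoefD f g u : (f + g) u = f u + g u. Proof. by []. Qed.
Lemma pscoefN f u : (- f) u = - f u. Proof. by []. Qed.
Lemma pscoef0 u : (0 : ncps d A) u = 0. Proof. by rewrite /= mul0rn. Qed.
Lemma pscoef1 u : (1 : ncps d A) u = (u == [::])%:R. Proof. by []. Qed.
Lemma pscoefM f g u :
  (f * g) u = \sum_(k < (size u).+1) f (take k u) * g (drop k u).
Proof. by []. Qed.

Lemma pscoef_sum (J : Type) (r : seq J) (F : J -> ncps d A) u :
  (\sum_(j <- r) F j) u = \sum_(j <- r) F j u.
Proof.
by elim: r => [|j r IHr]; rewrite ?big_nil ?pscoef0 // !big_cons pscoefD IHr.
Qed.

Lemma pscoef_prod_eq0 (J : Type) (r : seq J) (F : J -> ncps d A) u :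
  (forall j, F j [::] = 0) -> (size u < size r)%N ->
  (\prod_(j <- r) F j) u = 0.
Proof.
move=> F0; elim: r u => [//|j r IHr] [|i u] ltur; rewrite big_cons pscoefM.
  by rewrite big_ord1 F0 mul0r.
rewrite big_ord_recl F0 mul0r add0r big1 // => k _.
by rewrite IHr ?mulr0 // size_drop /= subSS (leq_ltn_trans (leq_subr _ _)).
Qed.

(* The geometric series of 1 - f. When f has constant term 1, the powers of
   degree > |u| do not contribute to the coefficient of z_u, and psinv f is the
   inverse of f: see psinvP. *)
Definition psinv f : ncps d A :=
  NCPS (fun u => (\sum_(n < (size u).+1) (1 - f) ^+ n) u).

Lemma psinvP f : f [::] = 1 -> f * psinv f = 1 /\ psinv f * f = 1.
Proof.
move=> f1; set h := 1 - f.
have h0 : h [::] = 0 by rewrite pscoefD pscoefN f1 pscoef1 subrr.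
have hX n u : (size u < n)%N -> (h ^+ n) u = 0.
  move=> ltun; rewrite -[n]subn0 -prodr_const_nat.
  by apply: pscoef_prod_eq0; rewrite ?size_iota ?subn0.
have psinvE N u : (size u < N)%N -> psinv f u = (\sum_(n < N) h ^+ n) u.
  move=> ltuN; rewrite /= !pscoef_sum.
  rewrite (big_ord_widen _ (fun n : nat => (h ^+ n) u) ltuN) big_mkcond /=.
  by apply: eq_bigr => n _; case: ltnP => // /hX ->.
have fE : f = 1 - h by rewrite /h opprB addrCA subrr addr0.
split; apply/ncpsP => u.
  transitivity ((f * \sum_(n < (size u).+1) h ^+ n) u).
    rewrite !pscoefM; apply: eq_bigr => k _; congr (_ * _).
    by apply: psinvE; rewrite ltnS size_drop leq_subr.
  rewrite fE -opprB mulNr -subrX1 opprB pscoefD pscoefN hX //.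
  by rewrite subr0.
transitivity (((\sum_(n < (size u).+1) h ^+ n) * f) u).
  rewrite !pscoefM; apply: eq_bigr => k _; congr (_ * _).
  by apply: psinvE; rewrite ltnS size_take_min geq_minr.
rewrite fE -opprB mulrN.
have /commrB : GRing.comm (\sum_(n < (size u).+1) h ^+ n) h.
  by apply/commr_sym/commr_sum => n _; apply: commrX.
move=> /(_ _ (commr1 _)) ->.
by rewrite -subrX1 opprB pscoefD pscoefN hX // subr0.
Qed.

End SeriesRing.

Definition psmap (d : nat) (A B : Type) (g : A -> B) (f : ncps d A) :
  ncps d B := NCPS (fun u => g (f u)).

(* f(V_1, ..., V_d) = \sum_u f_u V_(u 1) ... V_(u n), for V without constant
   terms: by pscoef_prod_eq0 the words u longer than w do not contribute to the
   coefficient of z_w. *)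
Definition pssubst (d : nat) (A : nzRingType) (f : ncps d A)
    (V : 'I_d -> ncps d A) : ncps d A :=
  NCPS (fun w => \sum_(n < (size w).+1) \sum_(u : n.-tuple 'I_d)
                   f u * (\prod_(i <- u) V i) w).

Notation ncpoly K d := {malg K[{fmonom 'I_d}]}.

Section Polynomials.
Variables (K : numClosedFieldType) (d : nat).
Local Notation poly := (ncpoly K d).
Implicit Types (phi kappa : {scalar poly}) (P Q : poly) (u v : seq 'I_d).

Definition ncX (i : 'I_d) : poly := << fmu i >>.

Definition ncmon u : poly := \prod_(i <- u) ncX i.

Lemma ncmonE u : ncmon u = << FMonom u >>.
Proof.
rewrite /ncmon; elim: u => [|i u IHu]; first by rewrite big_nil -fmoneE.
by rewrite big_cons IHu /ncX fmuE; apply: etrans (fgmulUU _ _ _ _) _;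
  rewrite mulr1; congr mkmalgU; apply: (fmmulE (FMonom [:: i])).
Qed.

Definition star P : poly := \sum_(m <- msupp P) (P@_m)^* *: ncmon (rev m).

Definition is_state phi : Prop :=
  [/\ phi 1 = 1,
      forall P, phi (star P) = (phi P)^* &
      forall P, 0 <= phi (star P * P)].

Definition is_MOPS phi (P : seq 'I_d -> poly) : Prop :=
  [/\ forall u m, m \in msupp (P u - ncmon u) -> (size m < size u)%N,
      P [::] = 1 &
      forall u v, u != v -> phi (star (P u) * P v) = 0].

Definition interval_partition n (p : {set {set 'I_n}}) : bool :=
  partition p [set: 'I_n] &&
  [forall B in p, forall i in B, forall j in B, forall k : 'I_n,
     (i <= k <= j)%N ==> (k \in B)].

Definition noncrossing_partition n (p : {set {set 'I_n}}) : bool :=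
  partition p [set: 'I_n] &&
  [forall B in p, forall B' in p, forall i in B, forall k in B,
   forall j in B', forall l in B', [&& i < j, j < k & k < l]%N ==> (B == B')].

(* [enum B] lists B in increasing order. *)
Definition subword u (B : {set 'I_(size u)}) : seq 'I_d :=
  [seq tnth (in_tuple u) i | i <- enum B].

Definition is_cumulant (S : forall n, pred {set {set 'I_n}}) phi kappa : Prop :=
  kappa 1 = 0 /\
  forall u, phi (ncmon u) = \sum_(p : {set {set 'I_(size u)}} | S (size u) p)
                              \prod_(B in p) kappa (ncmon (subword B)).

Definition is_boolean_cumulant := is_cumulant interval_partition.
Definition is_free_cumulant := is_cumulant noncrossing_partition.

Definition cumulant_gf kappa : ncps d K :=
  NCPS (fun u => if u is [::] then 0 else kappa (ncmon u)).

End Polynomials.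

Section FreeMeixner.
Variables (K : numClosedFieldType) (d : nat).
Local Notation poly := (ncpoly K d).
Implicit Types (phi eta rho : {scalar poly}).
Implicit Types (C : 'M[K]_(d * d)) (T : 'I_d -> 'M[K]_d).

Definition psdmx n (M : 'M[K]_n) : Prop :=
  forall v : 'cV[K]_n, 0 <= (map_mx Num.conj v^T *m M *m v) 0 0.

(* The standard basis vector e_i (x) e_j has index [mxtens_index (i, j)]. *)
Definition admissible C T : Prop :=
  [/\ forall i, T i \is hermsymmx,
      is_diag_mx C,
      psdmx (1%:M + C) &
      forall i, (T i *t 1%:M) *m C = C *m (T i *t 1%:M)].

Definition diag2 C (i j : 'I_d) : K :=
  C (mxtens_index (i, j)) (mxtens_index (i, j)).

(* The algebraic full Fock space has the basis << u >>, u a word, with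
   << [::] >> = Omega and << u >> = e_(u 1) (x) ... (x) e_(u n). *)
Local Notation fock := {malg K[seq 'I_d]}.

Definition fockX_basis C T (i : 'I_d) (u : seq 'I_d) : fock :=
  match u with
  | [::] => << [:: i] >>
  | [:: j] =>
      << [:: i; j] >> + \sum_k T i k j *: << [:: k] >>
      + (i == j)%:R *: << [::] >>
  | j :: (k :: xi) as v =>
      << [:: i, j, k & xi] >> + \sum_l T i l j *: << [:: l, k & xi] >>
      + ((i == j)%:R * (1 + diag2 C j k)) *: << k :: xi >>
  end.

Definition fockX C T i (x : fock) : fock :=
  \sum_(u <- msupp x) x@_u *: fockX_basis C T i u.

Definition fock_eval C T (P : poly) (x : fock) : fock :=
  \sum_(m <- msupp P) P@_m *: foldr (fockX C T) x (m : seq 'I_d).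

Definition fock_state C T (P : poly) : K := (fock_eval C T P << [::] >>)@_[::].

Definition pspoly (f : ncps d K) : ncps d poly := psmap (fun a => a%:MP) f.

Definition xdot (V : 'I_d -> ncps d K) : ncps d poly :=
  \sum_i psC d (ncX K i) * pspoly (V i).

Definition cond_B1 phi eta : Prop :=
  let e := cumulant_gf eta in
  exists V : 'I_d -> ncps d K,
    [/\ forall i, V i [::] = 0,
        forall i, pssubst (psD i e) V = psX K i &
        is_MOPS phi (psinv (1 - xdot V) * (1 - pspoly (pssubst e V)))].

Definition cond_B2 eta : Prop :=
  let e := cumulant_gf eta in
  exists C T, admissible C T /\
    forall i j, psD i (psD j e) =
      (i == j)%:R + \sum_k psC d (T i j k) * psD k e
      + psC d (1 + diag2 C i j) * psD i e * psD j e.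

Definition cond_F1 phi rho : Prop :=
  exists U : 'I_d -> ncps d K,
    (forall i, U i [::] = 0) /\
    is_MOPS phi (psinv (1 - xdot U + pspoly (pssubst (cumulant_gf rho) U))).

Definition cond_F2 phi : Prop :=
  exists C T, admissible C T /\ forall P, phi P = fock_state C T P.

Definition cond_F3 rho : Prop :=
  let r := cumulant_gf rho in
  exists C T, admissible C T /\
    forall i j, psD i (psD j r) =
      (i == j)%:R + \sum_k psC d (T i j k) * psD k r
      + psC d (diag2 C i j) * psD i r * psD j r.

Definition cond_F4 phi : Prop :=
  exists C T, admissible C T /\
  exists P : seq 'I_d -> poly,
    [/\ P [::] = 1,
        forall u, u != [::] -> phi (P u) = 0,
        forall i, ncX K i = P [:: i],
        forall i j, ncX K i * P [:: j] =
          P [:: i; j] + \sum_k T i k j *: P [:: k] + (i == j)%:R &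
        forall i j v w, let u := v :: w in
          ncX K i * P (j :: u) =
          P [:: i, j & u] + \sum_k T i k j *: P (k :: u)
          + ((i == j)%:R * (1 + diag2 C i v)) *: P u].

End FreeMeixner.

(* Main.v *)
From HB Require Import structures.
Require Import Defs.
From mathcomp Require Import all_boot all_order all_algebra.
From mathcomp Require Import sesquilinear boolp.
From mathcomp Require Import reals.

(** The whole proof turns around one system of moment identities for phi.
    Let m(z) be the moment series, e = eta(z) and r = R(z).  Grouping
    partitions by the block of the last letter gives
       m = 1 + m e            ([boolean_moment_series]),
       m = 1 + r(m z)         ([free_moment_series]),
    where m z is the tuple of the m z_i.  All the manipulations of series rest
    on two facts: a series V_1, ..., V_d without constant terms and with linear
    part z is left-independent, i.e. sum_i V_i Y_i = 0 forces Y = 0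
    ([left_independent]), and f(V) = f(0) + sum_i V_i (D_i f)(V)
    ([pssubst_split]), which makes f |-> f(V) an injective ring morphism.

    Boolean versus free.  Comparing the two expansions of m yields
    (D_i r)(m z) = D_i e and (D_i D_j r)(m z) = D_i D_j e - D_i e D_j e, so the
    substitution z |-> m z carries the quadratic equations for R to those for
    eta, the coefficient C_ij becoming 1 + C_ij ([boolean_free_pde_condP]).
    The same substitution U = m(V) V identifies the two generating functions
    ([free_gf_eq_boolean_gf], [free_gf_condP]).

    From a MOPS to the quadratic equations.  Since phi(x_i H) = (D_i e)(V) for
    the generating function H, orthogonality forces (D_i e)(V) = z_i
    ([boolean_gf_mops_inverse]).  Left independence then gives
       x_i H - z_i = sum_j N_ij D_j H,    N_ij = (D_i D_j e)(V),
    and pairing with P_j shows that N_ij has degree at most 2, its only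
    quadratic term being |P_ij|^2 z_i z_j.  Undoing the substitution gives the
    equations with 1 + C_ij = |P_ij|^2 and (T_i)_jk = N_ij[k]; self-adjointness
    of x_i makes the data admissible ([boolean_gf_mops_imp_pde]).

    From the equations to the recursion and back.  Given admissible (C, T), let
    N_ij be the quadratic series above.  The recursion for the P_u is exactly
    x_i H - z_i = sum_j N_ij D_j H, which is solved by
    H = (1 - x.V)^(-1) (1 - sum_i V_i z_i) where sum_i V_i N_ij = z_j
    ([gf_resolvent]).  So the condition phi(P_u) = 0 for nonempty u reads
    sum_i V_i z_i = e(V), and it follows from the equations by uniqueness of
    the solution of a contracting system ([boolean_pde_imp_recursion]);
    conversely the recursion makes the P_u orthogonal
    ([monic_recursion_orthogonal]), with H in resolvent form
    ([recursion_boolean_gf]).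

    Finally the recursion sends P_u to the basis vector e_u of the Fock space,
    so that phi is the Fock state iff phi(P_u) = 0 for all nonempty u
    ([cond_F2_recursion]). *)

Set Implicit Arguments.
Unset Strict Implicit.
Unset Printing Implicit Defensive.

Import Order.TTheory GRing.Theory Num.Theory.
Local Open Scope ring_scope.

(** * Splitting sums over set partitions *)

Lemma partition_restrict (T : finType) (p : {set {set T}}) (D1 D2 : {set T}) :
  [disjoint D1 & D2] -> partition p (D1 :|: D2) ->
  (forall B, B \in p -> B \subset D1 \/ B \subset D2) ->
  partition (p :&: powerset D1) D1.
Proof.
move=> dis pp spl; apply/and3P; split.
- apply/eqP/setP => x; apply/bigcupP/idP => [[B]|xD1].
    by rewrite !inE => /andP[_ /subsetP]; apply.
  have: x \in cover p by rewrite (cover_partition pp) inE xD1.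
  move=> /bigcupP[B Bp xB]; exists B => //; rewrite !inE Bp /=.
  have [//|/subsetP/(_ _ xB) xD2] := spl _ Bp.
  by have := disjointFr dis xD1; rewrite xD2.
- by case/and3P: pp => _ tI _; apply: trivIsetS tI; apply: subsetIl.
- by case/and3P: pp => _ _; rewrite !inE => /negPf->.
Qed.

Lemma partitionU (T : finType) (p1 p2 : {set {set T}}) (D1 D2 : {set T}) :
  [disjoint D1 & D2] -> partition p1 D1 -> partition p2 D2 ->
  partition (p1 :|: p2) (D1 :|: D2).
Proof.
move=> dis pp1 pp2; case/and3P: (pp1) => _ tI1 n1; case/and3P: (pp2) => _ tI2 n2.
apply/and3P; split; last by rewrite inE negb_or n1.
  by rewrite /cover bigcup_setU -!/(cover _) (cover_partition pp1) (cover_partition pp2).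
apply: trivIsetU => //.
by rewrite (cover_partition pp1) (cover_partition pp2).
Qed.

Lemma setU_powersetI (T : finType) (p1 p2 : {set {set T}}) (D1 D2 : {set T}) :
  [disjoint D1 & D2] -> partition p1 D1 -> partition p2 D2 ->
  (p1 :|: p2) :&: powerset D1 = p1.
Proof.
move=> dis pp1 pp2; apply/setP => B; rewrite !inE.
have [Bp1|_] /= := boolP (B \in p1); first by rewrite (partitionS pp1).
have [Bp2|//] /= := boolP (B \in p2); apply/negP => BD1.
have /set0Pn[x xB] := partition_neq0 pp2 Bp2.
have := disjointFr dis (subsetP BD1 x xB).
by rewrite (subsetP (partitionS pp2 Bp2) x xB).
Qed.

(** A partition that respects a decomposition of its support into D1 and D2
    is the union of its two traces, so the sum of products over blocks
    factorizes as soon as the condition P on partitions does. *)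
Lemma sum_partition_split (T : finType) (K : comNzRingType) (F : {set T} -> K)
    (D1 D2 : {set T}) (P P1 P2 : pred {set {set T}}) :
  [disjoint D1 & D2] ->
  (forall p, P p -> partition p (D1 :|: D2) /\
     (forall B, B \in p -> B \subset D1 \/ B \subset D2)) ->
  (forall p1 p2, partition p1 D1 -> partition p2 D2 ->
     P (p1 :|: p2) = P1 p1 && P2 p2) ->
  \sum_(p | P p) \prod_(B in p) F B =
  (\sum_(p | partition p D1 && P1 p) \prod_(B in p) F B) *
  (\sum_(p | partition p D2 && P2 p) \prod_(B in p) F B).
Proof.
move=> dis Psplit PU.
have dis' : [disjoint D2 & D1] by rewrite disjoint_sym.
have restr p : P p ->
    partition (p :&: powerset D1) D1 /\ partition (p :&: powerset D2) D2.
  move=> /Psplit[pp spl]; split; first exact: partition_restrict pp spl.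
  apply: partition_restrict dis' _ _; first by rewrite setUC.
  by move=> B /spl[]; [right|left].
rewrite big_distrlr pair_big /=.
rewrite (reindex_onto (fun q => q.1 :|: q.2)
  (fun p => (p :&: powerset D1, p :&: powerset D2))) /=; last first.
  move=> p /Psplit[_ spl]; rewrite -setIUr; apply/setIidPl/subsetP => B /spl.
  by rewrite !inE => -[]->; rewrite ?orbT.
apply: eq_big => [[p1 p2]|[p1 p2]] /=.
  apply/andP/andP => [[Pp /eqP[e1 e2]]|[/andP[pp1 Pp1] /andP[pp2 Pp2]]].
    have [] := restr _ Pp; rewrite e1 e2 => pp1 pp2.
    by move: Pp; rewrite PU // pp1 pp2 => /andP[-> ->].
  rewrite PU // Pp1 Pp2 (setU_powersetI dis) //.
  by rewrite setUC (setU_powersetI dis').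
case/andP=> [Pp /eqP[e1 e2]]; have [] := restr _ Pp; rewrite e1 e2 => pp1 pp2.
rewrite -bigU /=; first by apply: eq_bigl => B; rewrite !inE.
rewrite disjoint_subset; apply/subsetP => B Bp1; rewrite inE; apply/negP => Bp2.
have /set0Pn[x xB] := partition_neq0 pp2 Bp2.
have := disjointFr dis (subsetP (partitionS pp1 Bp1) x xB).
by rewrite (subsetP (partitionS pp2 Bp2) x xB).
Qed.

(** * Partitions of the letters of a word *)

(** The condition does not mention the ground set, so that it applies to
    partitions of any set of positions; [convex_blocks] is meant for
    segments. *)
Definition noncrossing n (p : {set {set 'I_n}}) : bool :=
  [forall B in p, forall B' in p, forall i in B, forall k in B,
   forall j in B', forall l in B', [&& i < j, j < k & k < l]%N ==> (B == B')].

Definition convex_blocks n (p : {set {set 'I_n}}) : bool :=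
  [forall B in p, forall i in B, forall j in B, forall k : 'I_n,
     (i <= k <= j)%N ==> (k \in B)].

Lemma noncrossingP n (p : {set {set 'I_n}}) :
  reflect (forall B B' (i j k l : 'I_n), B \in p -> B' \in p ->
             i \in B -> j \in B' -> k \in B -> l \in B' ->
             (i < j < k)%N -> (k < l)%N -> B = B')
          (noncrossing p).
Proof.
apply: (iffP forallP) => [H B B' i j k l Bp Bp' iB jB kB lB /andP[ij jk] kl|H B].
  move: (H B); rewrite Bp /= => /forallP/(_ B'); rewrite Bp' => /forallP/(_ i).
  rewrite iB => /forallP/(_ k); rewrite kB => /forallP/(_ j); rewrite jB.
  by move=> /forallP/(_ l); rewrite lB ij jk kl => /eqP.
apply/implyP => Bp; apply/forallP => B'; apply/implyP => Bp'.
apply/forallP => i; apply/implyP => iB; apply/forallP => k; apply/implyP => kB.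
apply/forallP => j; apply/implyP => jB; apply/forallP => l; apply/implyP => lB.
by apply/implyP => /and3P[ij jk kl]; apply/eqP/(H B B' i j k l); rewrite ?ij.
Qed.

Lemma convex_blocksP n (p : {set {set 'I_n}}) :
  reflect (forall B (i j k : 'I_n), B \in p -> i \in B -> j \in B ->
             (i <= k <= j)%N -> k \in B)
          (convex_blocks p).
Proof.
apply: (iffP forallP) => [H B i j k Bp iB jB ikj|H B].
  move: (H B); rewrite Bp /= => /forallP/(_ i).
  by rewrite iB => /forallP/(_ j); rewrite jB => /forallP/(_ k); rewrite ikj.
apply/implyP => Bp.
apply/forallP => i; apply/implyP => iB; apply/forallP => j; apply/implyP => jB.
by apply/forallP => k; apply/implyP; apply: H Bp iB jB.
Qed.

Lemma sorted_enum_ord_set n (A : {set 'I_n}) :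
  sorted (fun i j : 'I_n => (i < j)%N) (enum A).
Proof.
have trlt : transitive (fun i j : 'I_n => (i < j)%N).
  by move=> x y z; apply: ltn_trans.
have -> : enum A = filter (mem A) (enum 'I_n).
  by rewrite enumT; apply: eq_filter.
apply: sorted_filter => //.
by have := iota_ltn_sorted 0 n; rewrite -val_enum_ord sorted_map.
Qed.

Lemma enum_ord_setP n (A : {set 'I_n}) (s : seq 'I_n) :
  sorted (fun i j : 'I_n => (i < j)%N) s -> s =i A -> enum A = s.
Proof.
move=> srt sA; apply: irr_sorted_eq (sorted_enum_ord_set A) srt _ => //.
- by move=> x y z; apply: ltn_trans.
- by move=> x; rewrite /= ltnn.
by move=> x; rewrite sA mem_enum.
Qed.

Section Words.
Variables (d : nat) (K : comNzRingType) (kappa : seq 'I_d -> K).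
Implicit Types (u v : seq 'I_d) (S : forall n, pred {set {set 'I_n}}).

Lemma subword_imset u u' (f : 'I_(size u') -> 'I_(size u)) (B : {set 'I_(size u')}) :
  (forall x y : 'I_(size u'), (x < y)%N -> (f x < f y)%N) ->
  (forall x, tnth (in_tuple u) (f x) = tnth (in_tuple u') x) ->
  subword (f @: B) = subword B.
Proof.
move=> f_lt f_nth; rewrite /subword.
have -> : enum (f @: B) = map f (enum B).
  apply: enum_ord_setP => [|x].
    by rewrite sorted_map; apply: sub_sorted (sorted_enum_ord_set B) => x y /f_lt.
  apply/mapP/imsetP => -[y yB ->]; exists y => //; first by rewrite -mem_enum.
  by rewrite mem_enum.
by rewrite -map_comp; apply: eq_map => x /=; rewrite f_nth.
Qed.

Lemma subwordU1 u (i : 'I_(size u)) (B : {set 'I_(size u)}) :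
  (forall x, x \in B -> (x < i)%N) ->
  subword (i |: B) = rcons (subword B) (tnth (in_tuple u) i).
Proof.
move=> Bi; rewrite /subword -map_rcons; congr map.
apply: enum_ord_setP => [|x]; last first.
  by rewrite mem_rcons in_cons mem_enum !inE.
have := sorted_enum_ord_set B.
have : all (fun x : 'I_(size u) => (x < i)%N) (enum B).
  by apply/allP => x; rewrite mem_enum; apply: Bi.
case: (enum B) => [//|x s] /= /andP[xi /allP si] srt.
rewrite rcons_path srt /=.
by have := mem_last x s; rewrite inE => /predU1P[->//|/si].
Qed.

(** The moment-cumulant sum over the partitions of a set A of positions of u
    that satisfy S.  Keeping the word u fixed while A varies avoids
    transporting partitions along each step of the recursions below. *)
Definition partition_sum (S : forall n, pred {set {set 'I_n}}) u
    (A : {set 'I_(size u)}) : K :=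
  \sum_(p | partition p A && S (size u) p) \prod_(B in p) kappa (subword B).

Lemma partition_sum_imset S u u' (f : 'I_(size u') -> 'I_(size u)) :
  (forall x y : 'I_(size u'), (x < y)%N -> (f x < f y)%N) ->
  (forall x, tnth (in_tuple u) (f x) = tnth (in_tuple u') x) ->
  (forall p : {set {set 'I_(size u')}},
     S _ [set f @: (B : {set 'I__}) | B in p] = S _ p) ->
  partition_sum S (f @: setT) = partition_sum S [set: 'I_(size u')].
Proof.
move=> f_lt f_nth SE; have f_inj : injective f.
  move=> x y fxy; have [xy|yx|/val_inj//] := ltngtP x y.
    by have := f_lt _ _ xy; rewrite fxy ltnn.
  by have := f_lt _ _ yx; rewrite fxy ltnn.
pose h (p : {set {set 'I_(size u')}}) := [set f @: (B : {set 'I__}) | B in p].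
pose h' (q : {set {set 'I_(size u)}}) := [set f @^-1: (B : {set 'I__}) | B in q].
have hK p : h' (h p) = p.
  rewrite /h' /h -imset_comp -[RHS]imset_id; apply: eq_imset => B /=.
  by apply/setP => x; rewrite inE (mem_imset _ _ f_inj).
rewrite /partition_sum (reindex_onto h h') => [|q /andP[pq _]].
  apply: eq_big => [p|p _].
    by rewrite hK eqxx andbT SE (imset_partition _ _ f_inj).
  rewrite big_imset /=; last by move=> B B' _ _ /(imset_inj f_inj).
  by apply: eq_bigr => B _; rewrite (subword_imset _ f_lt f_nth).
rewrite /h /h' -imset_comp -[RHS]imset_id; apply: eq_in_imset => B Bq /=.
apply/setP => x; apply/imsetP/idP => [[y]|xB]; first by rewrite inE => yB ->.
have /imsetP[y _ xE] := subsetP (partitionS pq Bq) _ xB.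
by exists y => //; rewrite inE -xE.
Qed.

Lemma partition_sum_factor S (v1 v2 u : seq 'I_d) :
  (forall n m (f : 'I_n -> 'I_m) (p : {set {set 'I_n}}) a,
     (forall x, f x = a + x :> nat)%N -> 
     S _ [set f @: (B : {set 'I_n}) | B in p] = S _ p) ->
  partition_sum S [set x : 'I_(size (v1 ++ u ++ v2)) |
            (size v1 <= x < size v1 + size u)%N] =
  partition_sum S [set: 'I_(size u)].
Proof.
move=> SE; pose w := v1 ++ u ++ v2.
have ltf (x : 'I_(size u)) : (size v1 + x < size w)%N.
  by rewrite !size_cat ltn_add2l ltn_addr.
pose f (x : 'I_(size u)) : 'I_(size w) := Ordinal (ltf x).
rewrite -(@partition_sum_imset S _ _ f) => [|x y|x|p].
- congr partition_sum; apply/setP => x; rewrite inE; apply/idP/imsetP => [/andP[vx xv]|].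
    have ltx : (x - size v1 < size u)%N by rewrite ltn_subLR.
    by exists (Ordinal ltx) => //; apply: val_inj; rewrite /= subnKC.
  by case=> y _ -> /=; rewrite leq_addr ltn_add2l ltn_ord.
- by rewrite ltn_add2l.
- have x0 := tnth (in_tuple u) x.
  rewrite !(tnth_nth x0) /= /w nth_cat ltnNge leq_addr /= addKn.
  by rewrite nth_cat ltn_ord.
- exact: (SE _ _ _ _ (size v1)).
Qed.

Lemma noncrossing_imset n m (f : 'I_n -> 'I_m) (p : {set {set 'I_n}}) a :
  (forall x, f x = a + x :> nat)%N ->
  noncrossing [set f @: (B : {set 'I_n}) | B in p] = noncrossing p.
Proof.
move=> fE; have f_inj : injective f.
  by move=> x y /(congr1 val); rewrite /= !fE => /addnI/val_inj.
apply/noncrossingP/noncrossingP => H; last first.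
  move=> _ _ _ _ _ _ /imsetP[B Bp ->] /imsetP[B' Bp' ->] /imsetP[i iB ->]
    /imsetP[j jB ->] /imsetP[k kB ->] /imsetP[l lB ->].
  rewrite !fE !ltn_add2l => ijk kl.
  by rewrite (H B B' i j k l).
move=> B B' i j k l Bp Bp' iB jB kB lB ijk kl; apply: (imset_inj f_inj).
by apply: (H _ _ (f i) (f j) (f k) (f l)); rewrite ?imset_f // !fE !ltn_add2l.
Qed.

Lemma convex_blocks_imset n m (f : 'I_n -> 'I_m) (p : {set {set 'I_n}}) a :
  (forall x, f x = a + x :> nat)%N ->
  convex_blocks [set f @: (B : {set 'I_n}) | B in p] = convex_blocks p.
Proof.
move=> fE; have f_inj : injective f.
  by move=> x y /(congr1 val); rewrite /= !fE => /addnI/val_inj.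
apply/convex_blocksP/convex_blocksP => H.
  move=> B i j k Bp iB jB ikj; rewrite -(mem_imset _ _ f_inj).
  by apply: (H _ (f i) (f j) (f k)); rewrite ?imset_f // !fE !leq_add2l.
move=> _ _ _ k /imsetP[B Bp ->] /imsetP[i iB ->] /imsetP[j jB ->].
rewrite !fE => /andP[ik kj].
have ak : (a <= k)%N by rewrite (leq_trans _ ik) ?leq_addr.
have ltk : (k - a < n)%N.
  by rewrite ltn_subLR // (leq_ltn_trans kj) // ltn_add2l.
have -> : k = f (Ordinal ltk) by apply: val_inj; rewrite /= fE /= subnKC.
by rewrite imset_f // (H B i j) //= leq_subRL // ik leq_subLR.
Qed.

End Words.

(** * The block of the last letter *)

Lemma eq_pblock_mem (T : finType) (p : {set {set T}}) D (B : {set T}) x :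
  partition p D -> B \in p -> x \in B -> pblock p x = B.
Proof. by move=> /partition_trivIset tI; apply: def_pblock. Qed.

Section LastBlock.
Variables (N : nat) (lst : 'I_N).
Hypothesis lstP : forall x : 'I_N, (x <= lst)%N.
Implicit Types (p : {set {set 'I_N}}) (B D : {set 'I_N}).

(** The first position at or after s of the block of the last letter; the
    sums below are sorted according to it. *)
Definition block_start s p : 'I_N :=
  [arg min_(j < lst | (j \in pblock p lst) && (s <= j)) j]%N.

Lemma block_startP s p (i : 'I_N) : lst \in pblock p lst -> (s <= lst)%N ->
  reflect [/\ i \in pblock p lst, (s <= i)%N &
            forall j : 'I_N, j \in pblock p lst -> (s <= j)%N -> (i <= j)%N]
          (block_start s p == i).
Proof.
move=> lp sl; rewrite /block_start.
case: arg_minnP => [|i0 /andP[i0p si0] i0min]; first by rewrite lp.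
apply: (iffP eqP) => [<-|[ip si imin]].
  by split=> // j jp sj; apply: i0min; rewrite jp.
by apply: val_inj; apply/eqP; rewrite eqn_leq imin // i0min // ip.
Qed.

Lemma pblock_setU p1 p2 D1 D2 x : [disjoint D1 & D2] ->
  partition p1 D1 -> partition p2 D2 -> x \in D2 ->
  pblock (p1 :|: p2) x = pblock p2 x.
Proof.
move=> dis pp1 pp2 xD; apply: eq_pblock_mem (partitionU dis pp1 pp2) _ _.
  by rewrite inE pblock_mem ?orbT // (cover_partition pp2).
by rewrite mem_pblock (cover_partition pp2).
Qed.

(** The letters strictly between two consecutive elements of the last block
    form a union of blocks: a block with one letter there and another letter
    beyond i would cross the last block, which contains i and the last
    letter. *)
Lemma noncrossing_split (B0 : {set 'I_N}) (s : nat) (i : 'I_N) p :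
  (forall x, x \in B0 -> (x < s)%N) -> (s <= i)%N ->
  partition p (B0 :|: [set x : 'I_N | (s <= x)%N]) -> noncrossing p ->
  B0 \subset pblock p lst -> block_start s p == i ->
  forall B, B \in p -> B \subset [set x : 'I_N | (s <= x < i)%N] \/
                       B \subset (i |: B0) :|: [set x : 'I_N | (i < x)%N].
Proof.
move=> B0s si pp nc B0p.
have lD : lst \in B0 :|: [set x : 'I_N | (s <= x)%N].
  by rewrite !inE (leq_trans si) ?orbT.
have lp : lst \in pblock p lst by rewrite mem_pblock (cover_partition pp).
have Lp : pblock p lst \in p by rewrite pblock_mem // (cover_partition pp).
case/(block_startP _ lp (leq_trans si (lstP i))) => iL _ imin B Bp.
have [|/subsetPn[x xB]] := boolP (B \subset (i |: B0) :|: [set x : 'I_N | (i < x)%N]).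
  by right.
rewrite !inE !negb_or -leqNgt => /andP[/andP[xi xB0] lexi].
have ltxi : (x < i)%N by rewrite ltn_neqAle lexi andbT -val_eqE in xi *.
have sx : (s <= x)%N.
  by have := subsetP (partitionS pp Bp) _ xB; rewrite !inE (negPf xB0).
(* x lies before i, the first element of the last block from s on. *)
have BL : B <> pblock p lst.
  by move=> BL; have := imin x; rewrite -BL xB sx leqNgt ltxi => /(_ isT isT).
have notL y : y \in B -> y \notin pblock p lst.
  move=> yB; apply/negP => yL; apply: BL.
  by rewrite -(eq_pblock_mem pp Bp yB) (eq_pblock_mem pp Lp yL).
left; apply/subsetP => y yB; rewrite inE.
have := subsetP (partitionS pp Bp) _ yB; rewrite !inE.
case/orP => [yB0|sy]; first by have := notL _ yB; rewrite (subsetP B0p).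
rewrite sy ltnNge; apply/negP => iy; apply: BL.
have yi : y != i by apply: contraNneq (notL _ yB) => ->.
have yl : y != lst by apply: contraNneq (notL _ yB) => ->.
have lt_iy : (i < y)%N by rewrite ltn_neqAle iy andbT eq_sym -val_eqE in yi *.
have lt_yl : (y < lst)%N by rewrite ltn_neqAle lstP andbT -val_eqE in yl *.
by apply: (noncrossingP _ nc _ _ x i y lst) => //; rewrite ltxi.
Qed.

Lemma noncrossingU (B0 : {set 'I_N}) (s : nat) (i : 'I_N) p1 p2 :
  (forall x, x \in B0 -> (x < s)%N) -> (s <= i)%N ->
  partition p1 [set x : 'I_N | (s <= x < i)%N] ->
  partition p2 ((i |: B0) :|: [set x : 'I_N | (i < x)%N]) ->
  noncrossing (p1 :|: p2) = noncrossing p1 && noncrossing p2.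
Proof.
move=> B0s si pp1 pp2; apply/noncrossingP/andP => [nc|[nc1 nc2]].
  split; apply/noncrossingP => B B' a b c e Bp Bp' aB bB cB eB.
    by apply: nc aB bB cB eB; rewrite inE ?Bp ?Bp'.
  by apply: nc aB bB cB eB; rewrite inE ?Bp ?Bp' orbT.
have in1 B x : B \in p1 -> x \in B -> (s <= x < i)%N.
  by move=> Bp xB; have := subsetP (partitionS pp1 Bp) _ xB; rewrite inE.
have in2 B x : B \in p2 -> x \in B -> ~~ (s <= x < i)%N.
  move=> Bp xB; have := subsetP (partitionS pp2 Bp) _ xB; rewrite !inE.
  case/orP => [/predU1P[->|/B0s xs]|ix]; first by rewrite ltnn andbF.
    by rewrite leqNgt xs.
  by rewrite [(x < i)%N]ltnNge (ltnW ix) andbF.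
move=> B B' a b c e; rewrite !inE => /orP[Bp|Bp] /orP[Bp'|Bp'] aB bB cB eB.
- exact: (noncrossingP _ nc1) aB bB cB eB.
- case/andP=> ab bc ce; case/negP: (in2 _ _ Bp' bB).
  have /andP[sa _] := in1 _ _ Bp aB; have /andP[_ ci] := in1 _ _ Bp cB.
  by rewrite (leq_trans sa (ltnW ab)) (ltn_trans bc).
- case/andP=> ab bc ce; case/negP: (in2 _ _ Bp cB).
  have /andP[sa _] := in1 _ _ Bp' bB; have /andP[_ ci] := in1 _ _ Bp' eB.
  by rewrite (leq_trans sa (ltnW bc)) (ltn_trans ce).
- exact: (noncrossingP _ nc2) aB bB cB eB.
Qed.

Variables (K : comNzRingType) (F : {set 'I_N} -> K).

(** The sum over partitions in which B0 is the part already explored of the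
    block of the last letter, and the letters from s on are still free. *)
Definition open_sum B0 s : K :=
  \sum_(p | partition p (B0 :|: [set x : 'I_N | (s <= x)%N]) &&
            (noncrossing p && (B0 \subset pblock p lst))) \prod_(B in p) F B.

(** The next element i of the last block closes off the letters between s and
    i, which are partitioned independently of the rest. *)
Lemma open_sum_rec B0 s : (forall x, x \in B0 -> (x < s)%N) -> (s <= lst)%N ->
  open_sum B0 s =
  \sum_(i : 'I_N | (s <= i)%N)
    (\sum_(p | partition p [set x : 'I_N | (s <= x < i)%N] && noncrossing p)
        \prod_(B in p) F B) * open_sum (i |: B0) i.+1.
Proof.
move=> B0s sl; rewrite /open_sum.
have lD : lst \in B0 :|: [set x : 'I_N | (s <= x)%N] by rewrite !inE sl orbT.
have lp p : partition p (B0 :|: [set x : 'I_N | (s <= x)%N]) ->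
    lst \in pblock p lst.
  by move=> pp; rewrite mem_pblock (cover_partition pp).
rewrite (partition_big (block_start s) (fun i : 'I_N => s <= i)%N) /=; last first.
  move=> p /andP[pp _].
  by have [] := elimT (block_startP _ (lp _ pp) sl) (eqxx _).
apply: eq_bigr => i si; set D1 := [set x : 'I_N | (s <= x < i)%N].
set D2 := (i |: B0) :|: [set x : 'I_N | (i < x)%N].
have DE : B0 :|: [set x : 'I_N | (s <= x)%N] = D1 :|: D2.
  apply/setP => x; rewrite !inE -val_eqE /=.
  have [xB0|_] /= := boolP (x \in B0); first by rewrite !orbT.
  case: (ltngtP x i) => [xi|ix|xi] /=; rewrite ?andbT ?andbF ?orbF //.
    exact: leq_trans si (ltnW ix).
  by rewrite xi.
have dis : [disjoint D1 & D2].
  rewrite -setI_eq0; apply/eqP/setP => x; rewrite !inE -val_eqE /=.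
  apply/negP => /andP[/andP[sx xi]] /orP[/predU1P[xE|/B0s]|ix].
  - by rewrite xE ltnn in xi.
  - by rewrite ltnNge sx.
  - by have := ltn_trans xi ix; rewrite ltnn.
have lD2 : lst \in D2.
  rewrite !inE -val_eqE /=; have := lstP i.
  by rewrite leq_eqVlt eq_sym => /orP[->|->]; rewrite ?orbT.
pose P2 p := noncrossing p && (i |: B0 \subset pblock p lst).
apply (sum_partition_split (P1 := @noncrossing N) (P2 := P2) F dis) => [p|p1 p2 pp1 pp2].
  rewrite /P2 /=; case/andP=> /and3P[pp nc B0p] st; rewrite -DE; split=> //.
  exact: noncrossing_split st.
rewrite DE (partitionU dis pp1 pp2) (noncrossingU B0s si pp1 pp2) /=.
rewrite (pblock_setU dis pp1 pp2 lD2) -!andbA; congr (_ && (_ && _)).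
have pU : lst \in pblock (p1 :|: p2) lst by apply: lp; rewrite DE partitionU.
rewrite subUset sub1set.
apply/andP/andP => [[B0p /(block_startP _ pU sl)[]]|[iL B0p]].
  by rewrite (pblock_setU dis pp1 pp2 lD2).
split=> //; apply/(block_startP _ pU sl).
rewrite (pblock_setU dis pp1 pp2 lD2); split=> // j jL sj.
have L2 : pblock p2 lst \in p2 by rewrite pblock_mem ?(cover_partition pp2).
have := subsetP (partitionS pp2 L2) _ jL; rewrite !inE => /orP[/predU1P[->//|/B0s]|/ltnW//].
by rewrite ltnNge sj.
Qed.

Lemma open_sum_end B0 : lst \in B0 -> open_sum B0 N = F B0.
Proof.
move=> lB; rewrite /open_sum.
have -> : [set x : 'I_N | (N <= x)%N] = set0.
  by apply/setP => x; rewrite !inE leqNgt ltn_ord.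
rewrite setU0 (big_pred1 [set B0]) ?big_set1 // => p /=.
apply/and3P/eqP => [[pp nc B0p]|->].
  have Lp : pblock p lst \in p by rewrite pblock_mem ?(cover_partition pp).
  have LE : pblock p lst = B0.
    by apply/eqP; rewrite eqEsubset B0p (partitionS pp).
  apply/setP => B; rewrite inE; apply/idP/eqP => [Bp|->]; last by rewrite -LE.
  have /set0Pn[x xB] := partition_neq0 pp Bp.
  rewrite -LE -(eq_pblock_mem pp Bp xB) (eq_pblock_mem pp Lp) // LE.
  exact: subsetP (partitionS pp Bp) _ xB.
have pB : partition [set B0] B0.
  rewrite /partition /cover big_set1 eqxx inE /=; apply/andP; split.
    by apply/trivIsetP => A B /set1P-> /set1P->; rewrite eqxx.
  by apply: contraTneq lB => <-; rewrite inE.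
split=> //; last by rewrite (@eq_pblock_mem _ _ _ B0 _ pB) ?inE.
by apply/noncrossingP => B B' i j k l /set1P-> /set1P->.
Qed.

(** The last block of an interval partition is a final segment, and what
    precedes it is an arbitrary interval partition. *)
Lemma convex_sum_rec :
  \sum_(p | partition p [set: 'I_N] && convex_blocks p) \prod_(B in p) F B =
  \sum_(i : 'I_N)
    (\sum_(p | partition p [set x : 'I_N | (x < i)%N] && convex_blocks p)
        \prod_(B in p) F B) * F [set x : 'I_N | (i <= x)%N].
Proof.
have lp p : partition p [set: 'I_N] -> lst \in pblock p lst.
  by move=> pp; rewrite mem_pblock (cover_partition pp).
have Lp p : partition p [set: 'I_N] -> pblock p lst \in p.
  by move=> pp; rewrite pblock_mem // (cover_partition pp).
rewrite (partition_big (block_start 0) predT) //=.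
apply: eq_bigr => i _; set D1 := [set x : 'I_N | (x < i)%N].
set D2 := [set x : 'I_N | (i <= x)%N].
have LE p : partition p [set: 'I_N] -> convex_blocks p ->
    block_start 0 p == i -> pblock p lst = D2.
  move=> pp cv /(block_startP _ (lp _ pp) (leq0n _))[iL _ imin].
  apply/setP => x; rewrite inE; apply/idP/idP => [xL|ix]; first exact: imin.
  by apply: (convex_blocksP _ cv _ i lst) => //; rewrite ?Lp ?lp ?ix ?lstP.
have DE : [set: 'I_N] = D1 :|: D2.
  by apply/setP => x; rewrite !inE; case: leqP.
have dis : [disjoint D1 & D2].
  by rewrite -setI_eq0; apply/eqP/setP => x; rewrite !inE; case: leqP.
have lD2 : lst \in D2 by rewrite inE.
have pD2 : partition [set D2] D2.
  rewrite /partition /cover big_set1 eqxx inE /=; apply/andP; split.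
    by apply/trivIsetP => A B /set1P-> /set1P->; rewrite eqxx.
  by apply: contraTneq lD2 => <-; rewrite inE.
transitivity ((\sum_(p | partition p D1 && convex_blocks p) \prod_(B in p) F B) *
  (\sum_(p | partition p D2 && (p == [set D2])) \prod_(B in p) F B)); last first.
  congr (_ * _); rewrite (big_pred1 [set D2]) ?big_set1 // => p /=.
  by apply: andb_idl => /eqP->.
apply (sum_partition_split (P1 := @convex_blocks N) (P2 := pred1 [set D2]) F dis)
  => [p|p1 p2 pp1 pp2].
  case/andP=> /andP[pp cv] st; rewrite -DE; split=> // B Bp.
  have [/exists_inP[x xB xD2]|] := boolP [exists x in B, x \in D2].
    right; rewrite -(LE p) // in xD2 *.
    by rewrite -(eq_pblock_mem pp Bp xB) (eq_pblock_mem pp (Lp _ pp) xD2).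
  rewrite negb_exists => /forallP nD2; left; apply/subsetP => x xB.
  by have := nD2 x; rewrite xB !inE -ltnNge.
have ppU : partition (p1 :|: p2) setT by rewrite DE partitionU.
rewrite ppU /=.
apply/andP/andP => [[cv st]|[cv1 /eqP p2E]].
  have := LE _ ppU cv st; rewrite (pblock_setU dis pp1 pp2) // => L2.
  split.
    apply/convex_blocksP => B a b c Bp; apply: (convex_blocksP _ cv).
    by rewrite inE Bp.
  have L2p : pblock p2 lst \in p2 by rewrite pblock_mem // (cover_partition pp2).
  apply/eqP/setP => B; rewrite inE; apply/idP/eqP => [Bp|->]; last by rewrite -L2.
  have /set0Pn[x xB] := partition_neq0 pp2 Bp.
  rewrite -L2 -(eq_pblock_mem pp2 Bp xB) (eq_pblock_mem pp2 L2p) // L2.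
  exact: subsetP (partitionS pp2 Bp) _ xB.
have L2 : pblock p2 lst = D2 by rewrite (@eq_pblock_mem _ _ _ D2 _ pp2) // p2E inE.
split.
  apply/convex_blocksP => B a b c; rewrite p2E !inE => /orP[Bp|/eqP->].
    by apply: (convex_blocksP _ cv1).
  by rewrite !inE => ia _ /andP[ac _]; apply: leq_trans ac.
apply/(block_startP _ (lp _ ppU) (leq0n _)); rewrite (pblock_setU dis pp1 pp2) // L2.
by split=> [|//|j]; rewrite inE.
Qed.

End LastBlock.

(** * Recursions for sums over interval and non-crossing partitions *)

Section WordSums.
Variables (d : nat) (K : comNzRingType) (kappa : seq 'I_d -> K).
Implicit Types (u v w : seq 'I_d).

Lemma subword_geq u i : subword [set x : 'I_(size u) | (i <= x)%N] = drop i u.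
Proof.
rewrite /subword.
have -> : enum [set x : 'I_(size u) | (i <= x)%N] = drop i (enum 'I_(size u)).
  apply: enum_ord_setP => [|x].
    have := iota_ltn_sorted 0 (size u); rewrite -val_enum_ord sorted_map.
    by move=> srt; rewrite drop_sorted.
  rewrite inE -(mem_map val_inj) map_drop val_enum_ord drop_iota mem_iota add0n.
  have [ix|//] := leqP i x; rewrite subnKC ?ltn_ord //.
  by rewrite (leq_trans ix) // ltnW.
by rewrite map_drop map_tnth_enum.
Qed.

(** Only the subword read off along a segment matters: translation of
    positions is order preserving, hence compatible with both classes of
    partitions. *)
Lemma partition_sum_segment S w a b :
  (forall n m (f : 'I_n -> 'I_m) (p : {set {set 'I_n}}) a,
     (forall x, f x = a + x :> nat)%N ->
     S _ [set f @: (B : {set 'I_n}) | B in p] = S _ p) ->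
  (a <= b <= size w)%N ->
  partition_sum kappa S [set x : 'I_(size w) | (a <= x < b)%N] =
  partition_sum kappa S [set: 'I_(size (take (b - a) (drop a w)))].
Proof.
move=> SE /andP[ab bw].
pose w' := take a w ++ take (b - a) (drop a w) ++ drop b w.
have wE : w = w'.
  rewrite /w' -[in drop b w](subnK ab) -drop_drop cat_take_drop.
  by rewrite cat_take_drop.
have sa : size (take a w) = a by rewrite size_takel // (leq_trans ab).
have sb : size (take (b - a) (drop a w)) = (b - a)%N.
  by rewrite size_takel // size_drop leq_sub2r.
have := partition_sum_factor kappa (take a w) (drop b w) (take (b - a) (drop a w)) SE.
rewrite -/w'.
have H w1 : w = w1 ->
    partition_sum kappa S [set x : 'I_(size w) | (a <= x < b)%N] =
    partition_sum kappa S [set x : 'I_(size w1) | (a <= x < b)%N] by move=> <-.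
by move=> <-; rewrite sa sb subnKC //; apply: H.
Qed.

Definition interval_sum u : K := partition_sum kappa convex_blocks [set: 'I_(size u)].
Definition noncrossing_sum u : K := partition_sum kappa noncrossing [set: 'I_(size u)].

Lemma last_index u : u != [::] ->
  exists l : 'I_(size u), forall x : 'I_(size u), (x <= l)%N.
Proof.
case: u => // i u _; exists ord_max => x; exact: leq_ord.
Qed.

Lemma interval_sum_rec u : u != [::] ->
  interval_sum u = \sum_(j < size u) interval_sum (take j u) * kappa (drop j u).
Proof.
move=> /last_index[l lP].
rewrite /interval_sum /partition_sum (convex_sum_rec lP); apply: eq_bigr => j _.
rewrite subword_geq; congr (_ * _).
have := @partition_sum_segment convex_blocks u 0 j (@convex_blocks_imset).
by rewrite subn0 drop0; apply; exact: ltnW (ltn_ord j).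
Qed.

(** Non-crossing sums are determined by following the last block letter by
    letter: X v u stands for the contribution of the partitions whose last block
    starts with v, the letters of u being those still to be read. *)
Lemma noncrossing_sum_rec (X : seq 'I_d -> seq 'I_d -> K) :
  (forall v, X v [::] = kappa v) ->
  (forall v u x0, u != [::] -> X v u =
     \sum_(j < size u) noncrossing_sum (take j u) *
                       X (rcons v (nth x0 u j)) (drop j.+1 u)) ->
  forall u, u != [::] -> noncrossing_sum u = X [::] u.
Proof.
move=> X0 Xrec u /last_index[l lP].
pose F (B : {set 'I_(size u)}) := kappa (subword B).
suff H k s (B0 : {set 'I_(size u)}) : (size u - s <= k)%N -> (s <= size u)%N ->
    (forall x, x \in B0 -> (x < s)%N) -> (s = size u -> l \in B0) ->
    open_sum l F B0 s = X (subword B0) (drop s u).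
  have s0 : subword (set0 : {set 'I_(size u)}) = [::] by rewrite /subword enum_set0.
  have := H (size u) 0 set0; rewrite leq_subr drop0 s0 => <- //; last 2 first.
  - by move=> x; rewrite inE.
  - by move=> u0; exfalso; have := leq_ltn_trans (leq0n l) (ltn_ord l); rewrite -u0.
  - rewrite /open_sum /noncrossing_sum /partition_sum; apply: eq_bigl => p.
    rewrite sub0set andbT; congr (partition _ _ && _); apply/setP => x.
    by rewrite !inE.
elim: k s B0 => [|k IH] s B0 le_k le_s B0s lB0.
  have sE : s = size u by apply/eqP; rewrite eqn_leq le_s /= -subn_eq0 -leqn0.
  by rewrite sE drop_size X0 open_sum_end ?lB0.
have [sE|ltsu] := eqVneq s (size u).
  by rewrite sE drop_size X0 open_sum_end ?lB0.
have lt_s : (s < size u)%N by rewrite ltn_neqAle ltsu.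
have x0 := tnth (in_tuple u) l.
have sl : (s <= l)%N by exact: lP (Ordinal lt_s).
rewrite (open_sum_rec lP) // (Xrec _ _ x0); last first.
  by rewrite -size_eq0 size_drop subn_eq0 -ltnNge.
pose G i := noncrossing_sum (take (i - s) (drop s u)) *
            X (rcons (subword B0) (nth x0 u i)) (drop i.+1 u).
transitivity (\sum_(i < size u | (s <= i)%N) G i).
  apply: eq_bigr => i si; rewrite /G.
  have -> : noncrossing_sum (take (i - s) (drop s u)) =
      partition_sum kappa noncrossing [set x : 'I_(size u) | (s <= x < i)%N].
    rewrite (@partition_sum_segment noncrossing) //; first exact: noncrossing_imset.
    by rewrite si ltnW.
  rewrite /partition_sum; congr (_ * _).
  have B0i x : x \in B0 -> (x < i)%N by move=> /B0s/leq_trans; apply.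
  rewrite IH //.
  - by rewrite subwordU1 // (tnth_nth x0).
  - by rewrite leq_subLR addSnnS -leq_subLR (leq_trans (leq_sub2l _ si)).
  - by move=> x; rewrite !inE => /predU1P[->//|/B0i /ltnW].
  - move=> iE; rewrite !inE; apply/orP; left; rewrite -val_eqE /=.
    by rewrite eqn_leq lP /= -ltnS iE ltn_ord.
rewrite -(big_mkord (fun i => s <= i)%N G) -{1}[s]add0n.
rewrite (big_cat_nat (n := s)) //= big1_seq ?add0r; last first.
  by move=> i; rewrite mem_index_iota add0n => /andP[si /=]; rewrite ltnNge si.
rewrite size_drop -{1}[s]add0n big_addn -(big_mkord predT (fun j =>
  noncrossing_sum (take j (drop s u)) *
  X (rcons (subword B0) (nth x0 (drop s u) j)) (drop j.+1 (drop s u)))) /=.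
apply: eq_big => [j|j _]; first by rewrite add0n leq_addl.
by rewrite /G addnK nth_drop drop_drop addSn addnC.
Qed.

End WordSums.

(** * Non-commutative series *)

Section Series.
Variables (d : nat) (A : nzRingType).
Implicit Types (f g h : ncps d A) (u v w : seq 'I_d) (a b : A).

Lemma pscoefM0 f g : (f * g) [::] = f [::] * g [::].
Proof. exact: psmul_nil. Qed.

Lemma pscoefCM a f u : (psC d a * f) u = a * f u.
Proof. exact: psmulCl. Qed.

Lemma pscoefMC f a u : (f * psC d a) u = f u * a.
Proof.
rewrite pscoefM big_ord_recr /= drop_size take_size eqxx mulr1n big1 ?add0r //.
move=> k _; have -> : drop k u == [::] = false; last by rewrite mulr0n mulr0.
by rewrite -size_eq0 size_drop subn_eq0 leqNgt ltn_ord.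
Qed.

Fact psC_is_zmod_morphism : zmod_morphism (@psC d A).
Proof. by move=> a b; apply/ncpsP => u; rewrite /= mulrnBl. Qed.
HB.instance Definition _ :=
  GRing.isZmodMorphism.Build A (ncps d A) (@psC d A) psC_is_zmod_morphism.

Fact psC_is_monoid_morphism : monoid_morphism (@psC d A).
Proof.
split=> [|a b]; first exact/ncpsP.
by apply/ncpsP => u; rewrite pscoefCM /= mulrnAr.
Qed.
HB.instance Definition _ :=
  GRing.isMonoidMorphism.Build A (ncps d A) (@psC d A) psC_is_monoid_morphism.

Lemma psD_M i f g : psD i (f * g) = psC d (f [::]) * psD i g + psD i f * g.
Proof. exact: psD_mul. Qed.

Fact psD_is_zmod_morphism i : zmod_morphism (@psD d A i).
Proof. by move=> f g; apply/ncpsP. Qed.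
HB.instance Definition _ i :=
  GRing.isZmodMorphism.Build (ncps d A) (ncps d A) (@psD d A i)
    (psD_is_zmod_morphism i).

Lemma psD_C i a : psD i (psC d a) = 0.
Proof. by apply/ncpsP => u; rewrite pscoef0 /= mulr0n. Qed.

Lemma psD_X (i j : 'I_d) : psD i (psX A j) = (i == j)%:R.
Proof.
apply/ncpsP => u; rewrite /= eqseq_cons.
by case: (i == j) => //; rewrite pscoef0.
Qed.

Lemma psD_XM i j f : psD i (psX A j * f) = (i == j)%:R * f.
Proof. by rewrite psD_M psD_X /= raddf0 mul0r add0r. Qed.

Lemma psD_sum (J : Type) (r : seq J) i (F : J -> ncps d A) :
  psD i (\sum_(j <- r) F j) = \sum_(j <- r) psD i (F j).
Proof. exact: raddf_sum. Qed.

Lemma coef_sumX (X : 'I_d -> ncps d A) i u : (\sum_j psX A j * X j) (i :: u) = X i u.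
Proof.
rewrite -[LHS]/(psD i _ u) psD_sum; congr (pscoef _ u).
rewrite (bigD1 i) // big1 => [|j ji]; rewrite psD_XM ?eqxx.
  by rewrite mul1r /= addr0.
by rewrite eq_sym (negPf ji) mul0r.
Qed.

Lemma coef_sumX0 (X : 'I_d -> ncps d A) : (\sum_j psX A j * X j) [::] = 0.
Proof. by rewrite pscoef_sum big1 // => j _; rewrite pscoefM0 /= mul0r. Qed.

Lemma ps_split f : f = psC d (f [::]) + \sum_i psX A i * psD i f.
Proof.
apply/ncpsP => -[|i u]; rewrite pscoefD ?coef_sumX0 ?coef_sumX /= ?addr0 //.
by rewrite mulr0n add0r.
Qed.

(** Equality modulo words of length at least n: the neighbourhoods of the
    topology in which the fixed point arguments on series take place. *)
Definition agree n f g := forall u, (size u < n)%N -> f u = g u.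

Lemma agreeD n f f' g g' :
  agree n f f' -> agree n g g' -> agree n (f + g) (f' + g').
Proof. by move=> ff gg u un; rewrite !pscoefD ff ?gg. Qed.

Lemma agreeN n f f' : agree n f f' -> agree n (- f) (- f').
Proof. by move=> ff u un; rewrite !pscoefN ff. Qed.

Lemma agreeM n f f' g g' :
  agree n f f' -> agree n g g' -> agree n (f * g) (f' * g').
Proof.
move=> ff gg u un; rewrite !pscoefM; apply: eq_bigr => k _.
rewrite ff ?gg //; first by rewrite size_drop (leq_ltn_trans (leq_subr _ _)).
by rewrite size_take_min (leq_ltn_trans (geq_minr _ _)).
Qed.

Lemma agree_sum (J : Type) (r : seq J) n (F G : J -> ncps d A) :
  (forall j, agree n (F j) (G j)) -> agree n (\sum_(j <- r) F j) (\sum_(j <- r) G j).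
Proof. by move=> FG u un; rewrite !pscoef_sum; apply: eq_bigr => j _; apply: FG. Qed.

Lemma agree_mul0l n f g h :
  h [::] = 0 -> agree n f g -> agree n.+1 (h * f) (h * g).
Proof.
move=> h0 fg u un; rewrite !pscoefM !big_ord_recl /= !take0 h0 !mul0r; congr (_ + _).
apply: eq_bigr => k _; rewrite fg // size_drop /bump /= add1n.
by rewrite ltn_subLR ?ltn_ord // addSnnS (leq_trans un) // leq_addl.
Qed.

Lemma agree_mul0r n f g h :
  h [::] = 0 -> agree n f g -> agree n.+1 (f * h) (g * h).
Proof.
move=> h0 fg u un; rewrite !pscoefM !big_ord_recr /= !drop_size h0 !mulr0.
congr (_ + _); apply: eq_bigr => k _; rewrite fg //.
by rewrite size_take_min gtn_min (leq_trans (ltn_ord k) un).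
Qed.

(** Uniqueness for contractions: two families of series are equal as soon as
    agreement in one degree propagates to the next. *)
Lemma ps_eq_by_contraction (T : Type) (X Y : T -> ncps d A) :
  (forall n, (forall t, agree n (X t) (Y t)) -> forall t, agree n.+1 (X t) (Y t)) ->
  X =1 Y.
Proof.
move=> step; have H n : forall t, agree n (X t) (Y t).
  by elim: n => [t u //|n]; apply: step.
by move=> t; apply/ncpsP => u; apply: (H (size u).+1).
Qed.

(** The coefficients of length n of the iterates of a contraction are
    stationary from the step n + 1 on. *)
Lemma contraction_fixpoint (T : Type) (Phi : (T -> ncps d A) -> T -> ncps d A) :
  (forall n X Y, (forall t, agree n (X t) (Y t)) ->
                 forall t, agree n.+1 (Phi X t) (Phi Y t)) ->
  exists X, forall t, X t = Phi X t.
Proof.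
move=> step; pose a n := iter n Phi (fun=> 0).
have aS n : forall m t, agree n (a n t) (a (n + m)%N t).
  elim: n => [m t u //|n IH m t]; rewrite addSn; apply: step => t'; exact: IH.
pose X t := NCPS (fun u => a (size u).+1 t u).
have Xa n t : agree n (X t) (a n t).
  move=> u un; have := aS (size u).+1 (n - (size u).+1)%N t u (ltnSn _).
  by rewrite subnKC.
exists X => t; apply/ncpsP => u; rewrite /=.
by apply: (step (size u)) => // t' v vu; apply/esym/(Xa (size u)).
Qed.

(** The coefficient of z_k z_u in sum_i W_i Y_i is Y_k[u] plus terms that only
    involve shorter words of the Y_i. *)
Lemma left_independent (W Y : 'I_d -> ncps d A) :
  (forall i, W i [::] = 0) -> (forall i k, W i [:: k] = (i == k)%:R) ->
  \sum_i W i * Y i = 0 -> forall i, Y i = 0.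
Proof.
move=> W0 W1 WY0; apply: ps_eq_by_contraction => n IH k u un; rewrite pscoef0.
have /ncpsP/(_ (k :: u)) := WY0; rewrite pscoef0 pscoef_sum => <-.
have E i : (W i * Y i) (k :: u) = (i == k)%:R * Y i u.
  rewrite pscoefM !big_ord_recl /= W0 mul0r add0r take0 drop0 W1.
  rewrite big1 ?addr0 // => j _; rewrite IH ?pscoef0 ?mulr0 //.
  rewrite /bump /= !add1n size_drop /=.
  by rewrite ltn_subLR ?ltn_ord // addSnnS (leq_trans un) // leq_addl.
under eq_bigr => i _ do rewrite E.
rewrite (bigD1 k) //= eqxx mul1r big1 ?addr0 // => i ik.
by rewrite (negPf ik) mul0r.
Qed.

Lemma coef_mulX (f : ncps d A) i k :
  (f * psX A i) [::] = 0 /\ (f * psX A i) [:: k] = f [::] * (i == k)%:R.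
Proof.
split; first by rewrite pscoefM0 /= mulr0.
rewrite pscoefM big_ord_recl big_ord1 /= mulr0 addr0.
by rewrite eqseq_cons andbT eq_sym.
Qed.

End Series.

(** * Substitution of series *)

Section Substitution.
Variables (d : nat) (K : numClosedFieldType).
Implicit Types (f g h : ncps d K) (u v w : seq 'I_d) (V W : 'I_d -> ncps d K).

Lemma psC_comm (a : K) f : psC d a * f = f * psC d a.
Proof. by apply/ncpsP => u; rewrite pscoefCM pscoefMC mulrC. Qed.

Let layer V n f : ncps d K := \sum_(u : n.-tuple 'I_d) psC d (f u) * \prod_(i <- u) V i.

Let layerS V n f : layer V n.+1 f = \sum_i V i * layer V n (psD i f).
Proof.
rewrite /layer; under [RHS]eq_bigr => i _ do rewrite big_distrr /=.
rewrite pair_big (reindex (fun p : 'I_d * n.-tuple 'I_d => [tuple of p.1 :: p.2])) /=.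
  by apply: eq_bigr => -[i u] _; rewrite big_cons mulrA psC_comm -mulrA.
exists (fun u : n.+1.-tuple 'I_d => (thead u, [tuple of behead u])) => [[i u] _|u _].
  by congr (_, _); apply: val_inj.
by rewrite [RHS]tuple_eta.
Qed.

Let pssubst_layers V f N : (forall i, V i [::] = 0) ->
  agree N (pssubst f V) (\sum_(n < N) layer V n f).
Proof.
move=> V0 w wN; rewrite /= pscoef_sum.
rewrite (big_ord_widen _ (fun n => \sum_(u : n.-tuple 'I_d)
  f u * (\prod_(i <- u) V i) w) wN) big_mkcond /=.
apply: eq_bigr => n _; rewrite pscoef_sum; case: ifPn => [_|].
  by apply: eq_bigr => u _; rewrite pscoefCM.
rewrite -leqNgt => wn; rewrite big1 // => u _.
by rewrite pscoefCM pscoef_prod_eq0 ?mulr0 // size_tuple.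
Qed.

(** Splitting off the first letter of the monomials of f.  This determines f(V)
    by contraction, so that the algebraic laws of substitution follow from
    it. *)
Lemma pssubst_split f V : (forall i, V i [::] = 0) ->
  pssubst f V = psC d (f [::]) + \sum_i V i * pssubst (psD i f) V.
Proof.
move=> V0; apply/ncpsP => w.
rewrite (pssubst_layers f V0 (ltnSn _)) big_ord_recl.
transitivity ((psC d (f [::]) +
   \sum_i V i * \sum_(n < size w) layer V n (psD i f)) w).
  congr (pscoef _ w); congr (_ + _).
    rewrite /layer (big_pred1 [tuple]) ?big_nil ?mulr1 // => u.
    by apply/esym/eqP/val_inj; case: u => -[].
  under eq_bigr => n _ do rewrite layerS.
  by rewrite exchange_big; apply: eq_bigr => i _; rewrite big_distrr.
apply: (@agreeD _ _ (size w).+1) => //; apply: agree_sum => i.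
apply: agree_mul0l => // u uw; apply/esym.
exact: pssubst_layers.
Qed.

Variables (V : 'I_d -> ncps d K).
Hypothesis V0 : forall i, V i [::] = 0.

Lemma pssubst_coef0 f : pssubst f V [::] = f [::].
Proof.
rewrite pssubst_split // pscoefD /= pscoef_sum big1 ?addr0 // => i _.
by rewrite pscoefM0 V0 mul0r.
Qed.

(** Both sides of the algebraic laws of substitution solve a system of this
    form, whose state t records the series to be substituted. *)
Lemma left_linear_system_unique (T : Type) (c : T -> ncps d K) (s : 'I_d -> T -> T)
    (X Y : T -> ncps d K) :
  (forall t, X t = c t + \sum_i V i * X (s i t)) ->
  (forall t, Y t = c t + \sum_i V i * Y (s i t)) -> X =1 Y.
Proof.
move=> XE YE; apply: ps_eq_by_contraction => n IH t; rewrite XE YE.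
by apply: agreeD => //; apply: agree_sum => i; apply: agree_mul0l.
Qed.

Lemma pssubstC a : pssubst (psC d a) V = psC d a.
Proof.
apply: (left_linear_system_unique (c := fun a => psC d a) (s := fun _ _ => 0)
  (X := fun a => pssubst (psC d a) V) (Y := fun a => psC d a)) => b.
  rewrite pssubst_split //=; congr (psC d _ + _); apply: eq_bigr => i _.
  by rewrite psD_C raddf0.
by rewrite big1 ?addr0 // => i _; rewrite raddf0 mulr0.
Qed.

Lemma pssubstB f g : pssubst (f - g) V = pssubst f V - pssubst g V.
Proof.
apply: (left_linear_system_unique
  (c := fun p : ncps d K * ncps d K => psC d ((p.1 - p.2) [::]))
  (s := fun i p => (psD i p.1, psD i p.2))
  (X := fun p => pssubst (p.1 - p.2) V)
  (Y := fun p => pssubst p.1 V - pssubst p.2 V) _ _ (f, g)) => -[{}f {}g] /=.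
  by rewrite pssubst_split //; congr (_ + _); apply: eq_bigr => i _; rewrite raddfB.
rewrite (pssubst_split f) // (pssubst_split g) // raddfB /= opprD addrACA -sumrB.
by congr (_ + _); apply: eq_bigr => i _; rewrite mulrBr.
Qed.

Lemma pssubst0 : pssubst 0 V = 0.
Proof. by have := pssubstB 0 0; rewrite !subrr. Qed.

Lemma pssubstD f g : pssubst (f + g) V = pssubst f V + pssubst g V.
Proof.
have -> : f + g = f - (0 - g) by rewrite sub0r opprK.
by rewrite 2!pssubstB pssubst0 sub0r opprK.
Qed.

Lemma pssubst1 : pssubst 1 V = 1.
Proof. exact: pssubstC. Qed.

Lemma pssubst_sum (J : Type) (r : seq J) (F : J -> ncps d K) :
  pssubst (\sum_(j <- r) F j) V = \sum_(j <- r) pssubst (F j) V.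
Proof. exact: (big_morph (fun f => pssubst f V) pssubstD pssubst0). Qed.

Lemma pssubstM f g : pssubst (f * g) V = pssubst f V * pssubst g V.
Proof.
have H (a : K) h : pssubst (psC d a * h) V = psC d a * pssubst h V.
  apply: (left_linear_system_unique (c := fun h => psC d a * psC d (h [::]))
    (s := fun i h => psD i h) (X := fun h => pssubst (psC d a * h) V)
    (Y := fun h => psC d a * pssubst h V)) => {}h.
    rewrite pssubst_split // pscoefCM rmorphM; congr (_ + _).
    by apply: eq_bigr => i _; rewrite psD_M psD_C mul0r addr0 /= mulr1n.
  rewrite (pssubst_split h) // mulrDr mulr_sumr; congr (_ + _).
  by apply: eq_bigr => i _; rewrite !mulrA psC_comm.
move: f; apply: (left_linear_system_unique (c := fun f => psC d (f [::]) * pssubst g V)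
  (s := fun i f => psD i f)) => f.
  rewrite {1}(ps_split f) mulrDl pssubstD H; congr (_ + _).
  rewrite mulr_suml pssubst_sum; apply: eq_bigr => i _.
  rewrite -mulrA pssubst_split // pscoefM0 /= mul0r raddf0 add0r.
  rewrite (bigD1 i) //= big1 ?addr0 => [|j ji]; rewrite psD_XM ?eqxx ?mul1r //.
  by rewrite (negPf ji) mul0r pssubst0 mulr0.
rewrite {1}(pssubst_split f) // mulrDl mulr_suml; congr (_ + _).
by apply: eq_bigr => i _; rewrite mulrA.
Qed.

Lemma pssubst_sumM (X Y : 'I_d -> ncps d K) :
  pssubst (\sum_i X i * Y i) V = \sum_i pssubst (X i) V * pssubst (Y i) V.
Proof. by rewrite pssubst_sum; apply: eq_bigr => i _; rewrite pssubstM. Qed.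

Lemma pssubstX i : pssubst (psX K i) V = V i.
Proof.
rewrite pssubst_split //= raddf0 add0r (bigD1 i) //= big1 => [|j ji].
  by rewrite psD_X eqxx pssubst1 mulr1 addr0.
by rewrite psD_X (negPf ji) pssubst0 mulr0.
Qed.

Lemma pssubst_comp f W : (forall i, W i [::] = 0) ->
  pssubst (pssubst f W) V = pssubst f (fun i => pssubst (W i) V).
Proof.
move=> W0; have WV0 i : pssubst (W i) V [::] = 0 by rewrite pssubst_coef0.
move: f; apply: ps_eq_by_contraction => n IH f; rewrite (pssubst_split f) //.
rewrite (pssubst_split f WV0) pssubstD pssubstC pssubst_sumM.
by apply: agreeD => //; apply: agree_sum => i; apply: agree_mul0l.
Qed.

Hypothesis V1 : forall i k, V i [:: k] = (i == k)%:R.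

(** If f(V) = 0 then f has no constant term, so sum_i V_i (D_i f)(V) = 0 and,
    by left independence, each (D_i f)(V) vanishes. *)
Lemma pssubst_eq0 f : pssubst f V = 0 -> f = 0.
Proof.
move=> fV; apply/ncpsP => u; rewrite pscoef0; elim: u f fV => [|i u IH] f fV.
  by rewrite -pssubst_coef0 fV pscoef0.
apply: (IH (psD i f)); apply: (left_independent V0 V1 (Y := fun i => pssubst (psD i f) V)).
have f0 : f [::] = 0 by rewrite -pssubst_coef0 fV pscoef0.
by move: fV; rewrite pssubst_split // f0 raddf0 add0r.
Qed.

Lemma pssubst_inj f g : pssubst f V = pssubst g V -> f = g.
Proof.
move=> fg; apply/eqP; rewrite -subr_eq0 -(pssubst_eq0 (f := f - g)) //.
by rewrite pssubstB fg subrr.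
Qed.

End Substitution.

(** * Word algebras and the recursion of free Meixner polynomials *)

Section Admissible.
Variables (K : numClosedFieldType) (d : nat).
Implicit Types (u v : seq 'I_d) (i j k : 'I_d).
Implicit Types (C : 'M[K]_(d * d)) (T : 'I_d -> 'M[K]_d).

(** The coefficient of the annihilation part of the recursion, which is
    1 + C_ij if u starts with j, and 1 if u is empty.  With it the three
    cases of the recursion become one. *)
Definition lowering C i u : K := if u is v :: _ then 1 + diag2 C i v else 1.

Lemma admissible_herm C T i j k : admissible C T -> (T i k j)^* = T i j k.
Proof.
case=> /(_ i) hT _ _ _; have /is_hermitianmxP/matrixP/(_ j k) := hT.
by rewrite expr0 scale1r !mxE.
Qed.

Lemma psdmx_diag_ge0 n (M : 'M[K]_n) p : psdmx M -> 0 <= M p p.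
Proof.
move=> psd; have := psd (delta_mx p 0).
have -> : map_mx Num.conj (delta_mx p 0 : 'cV[K]_n)^T = delta_mx 0 p.
  by apply/matrixP => x y; rewrite !mxE rmorph_nat andbC.
by rewrite -rowE -colE !mxE.
Qed.

Lemma admissible_ge0 C T i j : admissible C T -> 0 <= 1 + diag2 C i j.
Proof.
case=> _ _ psd _; have := psdmx_diag_ge0 (mxtens_index (i, j)) psd.
by rewrite !mxE eqxx.
Qed.

Lemma admissible_lowering_conj C T i u :
  admissible C T -> (lowering C i u)^* = lowering C i u.
Proof.
move=> adm; case: u => [|v u] /=; first exact: rmorph1.
by apply/CrealP/ger0_real/(admissible_ge0 _ _ adm).
Qed.

(** The entries of (T_i (x) I) C = C (T_i (x) I): wherever T_i couples j and k,
    the coefficients C_jv and C_kv agree. *)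
Lemma admissible_lowering_comm C T i j k u : admissible C T ->
  T i j k * lowering C k u = T i j k * lowering C j u.
Proof.
case=> _ dC _ TC; case: u => [//|v u] /=.
have /matrixP/(_ (mxtens_index (j, v)) (mxtens_index (k, v))) := TC i.
have /is_diag_mxP dC' := dC.
rewrite !mxE (bigD1 (mxtens_index (k, v))) //= [X in _ + X]big1 ?addr0; last first.
  by move=> p pk; rewrite dC' ?mulr0 // -val_eqE.
rewrite (bigD1 (mxtens_index (j, v))) //= big1 ?addr0; last first.
  by move=> p pj; rewrite dC' ?mul0r // eq_sym.
rewrite tensmxE mxE eqxx mulr1 => TCjk.
by rewrite !mulrDr /diag2 TCjk [C _ _ * _]mulrC.
Qed.

End Admissible.

(** The properties of C<x_1, ..., x_d> used by the argument: constants are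
    central, there is an involution that fixes the variables, and a filtration
    by degree for which any monic family of polynomials spans ([below_ind]:
    [below n p] says that p is a combination of words of length less than
    n). *)
Record word_algebra (K : numClosedFieldType) (d : nat) := WordAlgebra {
  wa_ring :> nzRingType;
  cst : {rmorphism K -> wa_ring};
  var : 'I_d -> wa_ring;
  adj : wa_ring -> wa_ring;
  below : nat -> wa_ring -> Prop;
  cst_comm : forall a p, cst a * p = p * cst a;
  adjD : forall p q, adj (p + q) = adj p + adj q;
  adjM : forall p q, adj (p * q) = adj q * adj p;
  adjC : forall a, adj (cst a) = cst a^*;
  adjX : forall i, adj (var i) = var i;
  adjK : forall p, adj (adj p) = p;
  belowD : forall n p q, below n p -> below n q -> below n (p + q);
  belowC : forall n a p, below n p -> below n (cst a * p);
  belowX : forall n i p, below n p -> below n.+1 (var i * p);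
  belowW : forall n n' p, (n <= n')%N -> below n p -> below n' p;
  below_exists : forall p, exists n, below n p;
  below0_eq : forall n, below n 0;
  below_mon : forall u, below (size u).+1 (\prod_(i <- u) var i);
  below_ind : forall (B : seq 'I_d -> wa_ring) (S : wa_ring -> Prop) n,
    (forall u, below (size u) (B u - \prod_(i <- u) var i)) ->
    S 0 -> (forall p q, S p -> S q -> S (p + q)) ->
    (forall a p, S p -> S (cst a * p)) ->
    (forall u, (size u < n)%N -> S (B u)) ->
    forall p, below n p -> S p }.

Section Recursion.
Variables (K : numClosedFieldType) (d : nat) (W : word_algebra K d).
Implicit Types (p q : W) (u v : seq 'I_d) (i j k : 'I_d) (a : K).
Implicit Types (C : 'M[K]_(d * d)) (T : 'I_d -> 'M[K]_d).
Local Notation cst := (cst W).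
Local Notation var := (@var _ _ W).
Local Notation adj := (@adj _ _ W).
Local Notation below := (@below _ _ W).

Definition mon u : W := \prod_(i <- u) var i.

Lemma mon_cons i u : mon (i :: u) = var i * mon u.
Proof. by rewrite /mon big_cons. Qed.

Lemma mon_nil : mon [::] = 1.
Proof. by rewrite /mon big_nil. Qed.

Lemma belowN n p : below n p -> below n (- p).
Proof. by move=> np; rewrite -mulN1r -(rmorphN1 cst); apply: belowC. Qed.

Lemma below_sum (J : Type) (r : seq J) n (F : J -> W) :
  (forall t, below n (F t)) -> below n (\sum_(t <- r) F t).
Proof. by move=> nF; apply: big_ind => //; [apply: below0_eq|apply: belowD]. Qed.

Definition monic (P : seq 'I_d -> W) := forall u, below (size u) (P u - mon u).

Lemma monic_below P u : monic P -> below (size u).+1 (P u).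
Proof.
move=> mP; rewrite -[P u](subrK (mon u)); apply: belowD (@below_mon _ _ W u).
exact: (belowW (leqnSn _) (mP u)).
Qed.

Definition monic_recursion C T (P : seq 'I_d -> W) : Prop :=
  [/\ P [::] = 1, forall i, var i * P [::] = P [:: i] &
      forall i j u, var i * P (j :: u) =
        P [:: i, j & u] + \sum_k cst (T i k j) * P (k :: u)
        + cst ((i == j)%:R * lowering C i u) * P u].

(** Computes (i |-> P_(i,u), P_u) by structural recursion on u; the recursion
    for P_(i,j,u) calls P_(k,u) for all k, which is why all the first letters
    are carried along. *)
Fixpoint rec_pair C T u : ('I_d -> W) * W :=
  if u is j :: u' then
    let p := rec_pair C T u' in
    (fun i => var i * p.1 j - \sum_k cst (T i k j) * p.1 k
              - cst ((i == j)%:R * lowering C i u') * p.2, p.1 j)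
  else (fun i => var i, 1).
Definition rec_poly C T u := (rec_pair C T u).2.

Lemma rec_polyP C T : monic_recursion C T (rec_poly C T).
Proof.
split=> [//|i|i j u]; first exact: mulr1.
by rewrite /rec_poly /= addrAC subrK subrK.
Qed.

Lemma monic_recursion_monic C T P : monic_recursion C T P -> monic P.
Proof.
move=> [P0 P1 Prec] u; have [n] := ubnP (size u); elim: n u => // n IH [|i [|j u]] un.
- by rewrite P0 mon_nil subrr; apply: below0_eq.
- by rewrite -P1 P0 mon_cons mon_nil subrr; apply: below0_eq.
have PE : P [:: i, j & u] - mon [:: i, j & u] =
    var i * (P (j :: u) - mon (j :: u)) -
    (\sum_k cst (T i k j) * P (k :: u) + cst ((i == j)%:R * lowering C i u) * P u).
  by rewrite mulrBr Prec -mon_cons -[_ + _ + _]addrA addrAC addrK.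
rewrite PE; apply: belowD; first by apply: (@belowX _ _ W); apply: (IH (j :: u)).
have lowP v : (size v < size [:: i, j & u])%N -> below (size [:: i, j & u]) (P v).
  move=> vu; rewrite -[P v](subrK (mon v)); apply: belowD.
    by apply: (belowW (ltnW vu)); apply: (IH v); apply: leq_trans vu _.
  exact: (belowW vu (@below_mon _ _ W v)).
apply: belowN; apply: belowD; last by apply: belowC; apply: lowP.
by apply: below_sum => k; apply: belowC; apply: lowP.
Qed.

Variable phi : W -> K.
Hypothesis phi_lin : forall a p q, phi (cst a * p + q) = a * phi p + phi q.

Lemma phiD p q : phi (p + q) = phi p + phi q.
Proof. by have := phi_lin 1 p q; rewrite rmorph1 !mul1r. Qed.
Lemma phi0 : phi 0 = 0.
Proof. by apply: (addrI (phi 0)); rewrite -phiD !addr0. Qed.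
Lemma phiC a p : phi (cst a * p) = a * phi p.
Proof. by rewrite -[cst a * p]addr0 phi_lin phi0 addr0. Qed.
Lemma phiN p : phi (- p) = - phi p.
Proof. by apply: (addrI (phi p)); rewrite -phiD !subrr phi0. Qed.
Lemma phiB p q : phi (p - q) = phi p - phi q.
Proof. by rewrite phiD phiN. Qed.
Lemma phi_sum (J : Type) (r : seq J) (F : J -> W) :
  phi (\sum_(t <- r) F t) = \sum_(t <- r) phi (F t).
Proof. exact: (big_morph _ phiD phi0). Qed.

(** A monic family spans the algebra, so it determines linear functionals. *)
Lemma phi_eq (psi : W -> K) P :
  (forall a p q, psi (cst a * p + q) = a * psi p + psi q) ->
  monic P -> (forall u, phi (P u) = psi (P u)) -> phi =1 psi.
Proof.
move=> psi_lin mP PE p; have [n np] := @below_exists _ _ W p.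
have psi0 : psi 0 = 0.
  have := psi_lin 1 0 0; rewrite mulr0 add0r mul1r => /esym/eqP.
  by rewrite -subr_eq0 addrK => /eqP.
apply: (@below_ind _ _ W P (fun p => phi p = psi p) n) np => //.
- by rewrite phi0.
- by move=> q r qE rE; have := psi_lin 1 q r; rewrite rmorph1 !mul1r phiD qE rE.
- by move=> a q qE; have := psi_lin a q 0; rewrite !addr0 psi0 addr0 phiC qE.
Qed.

Definition ip p q : K := phi (adj p * q).

Lemma adj0 : adj 0 = 0.
Proof. by apply: (addrI (adj 0)); rewrite -adjD !addr0. Qed.
Lemma ipDl p p' q : ip (p + p') q = ip p q + ip p' q.
Proof. by rewrite /ip adjD mulrDl phiD. Qed.
Lemma ipDr p q q' : ip p (q + q') = ip p q + ip p q'.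
Proof. by rewrite /ip mulrDr phiD. Qed.
Lemma ipCl a p q : ip (cst a * p) q = a^* * ip p q.
Proof. by rewrite /ip adjM adjC -cst_comm -mulrA phiC. Qed.
Lemma ipCr a p q : ip p (cst a * q) = a * ip p q.
Proof. by rewrite /ip mulrA -cst_comm -mulrA phiC. Qed.
Lemma ip0l q : ip 0 q = 0.
Proof. by rewrite /ip adj0 mul0r phi0. Qed.
Lemma ip0r p : ip p 0 = 0.
Proof. by rewrite /ip mulr0 phi0. Qed.
Lemma ipNl p q : ip (- p) q = - ip p q.
Proof. by apply: (addrI (ip p q)); rewrite -ipDl !subrr ip0l. Qed.
Lemma ip_suml (J : Type) (r : seq J) (F : J -> W) q :
  ip (\sum_(t <- r) F t) q = \sum_(t <- r) ip (F t) q.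
Proof. exact: (big_morph (ip^~ q) (fun p p' => ipDl p p' q) (ip0l q)). Qed.
Lemma ip_sumr (J : Type) (r : seq J) p (F : J -> W) :
  ip p (\sum_(t <- r) F t) = \sum_(t <- r) ip p (F t).
Proof. exact: (big_morph (ip p) (ipDr p) (ip0r p)). Qed.
Lemma adj1 : adj 1 = 1.
Proof. by have := adjC W 1; rewrite !rmorph1. Qed.
Lemma ip1l q : ip 1 q = phi q.
Proof. by rewrite /ip adj1 mul1r. Qed.
Lemma ipXl i p q : ip (var i * p) q = ip p (var i * q).
Proof. by rewrite /ip adjM adjX mulrA. Qed.

Definition mops (P : seq 'I_d -> W) : Prop :=
  [/\ monic P, P [::] = 1 & forall u v, u != v -> ip (P u) (P v) = 0].

Lemma mops_phi P u : mops P -> u != [::] -> phi (P u) = 0.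
Proof. by case=> _ P1 orth u0; rewrite -ip1l -P1 orth // eq_sym. Qed.

(** The P_v with v shorter than u span the polynomials of degree less than
    |u|, and P_u is orthogonal to all of them. *)
Lemma mops_below P u q : mops P -> below (size u) q -> ip q (P u) = 0.
Proof.
case=> mP _ orth; apply: (@below_ind _ _ W P (fun q => ip q (P u) = 0)) => //.
- exact: ip0l.
- by move=> p p' p0 p'0; rewrite ipDl p0 p'0 addr0.
- by move=> a p p0; rewrite ipCl p0 mulr0.
by move=> v vu; apply: orth; apply: contraTneq vu => ->; rewrite ltnn.
Qed.

(** The squared norm of the basis vector e_u of the Fock space deformed by C,
    hence of P_u. *)
Fixpoint weight C u : K := if u is i :: u' then lowering C i u' * weight C u' else 1.

Hypothesis phi1 : phi 1 = 1.

(** By induction on u: the recursion expresses P_(i,j,u) through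
    x_i P_(j,u), x_i moves to the other side of the inner product, and the
    recursion applied to x_i P_v leaves only inner products with shorter left
    factors.  The three parts of x_i are then matched: annihilation against
    creation because weight(i,u) = lowering(i,u) weight(u), and T_i against
    itself because it is Hermitian and commutes with C. *)
Lemma monic_recursion_orthogonal C T P : admissible C T ->
  monic_recursion C T P -> (forall u, u != [::] -> phi (P u) = 0) ->
  forall u v, ip (P u) (P v) = (u == v)%:R * weight C u.
Proof.
move=> adm [P0 P1 Prec] Pphi u; have [n] := ubnP (size u).
elim: n u => // n IH [|i [|j u]] un v.
- rewrite P0 ip1l; case: v => [|k v]; first by rewrite P0 phi1 eqxx mul1r.
  by rewrite Pphi // mul0r.
- have -> : weight C [:: i] = 1 by rewrite /= mulr1.
  rewrite mulr1 -P1 ipXl P0 ip1l; case: v => [|k v].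
    by rewrite P1 Pphi // mul0r.
  rewrite Prec !phiD phi_sum phiC Pphi // add0r big1 ?add0r => [|l _].
    rewrite eqseq_cons; case: v => [|l v] /=; first by rewrite P0 phi1 andbT !mulr1.
    by rewrite Pphi // andbF mulr0.
  by rewrite phiC Pphi ?mulr0.
have PE : P [:: i, j & u] = var i * P (j :: u) -
    (\sum_k cst (T i k j) * P (k :: u) + cst ((i == j)%:R * lowering C i u) * P u).
  by rewrite Prec -[X in X - _]addrA addrK.
have IHj w : ip (P (j :: u)) (P w) = (j :: u == w)%:R * weight C (j :: u).
  by apply: IH.
have IHk k w : ip (P (k :: u)) (P w) = (k :: u == w)%:R * weight C (k :: u).
  by apply: IH.
have IHu w : ip (P u) (P w) = (u == w)%:R * weight C u.
  by apply: IH; exact: (@ltnW (size u).+1 n un).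
have lowering_conj : ((i == j)%:R * lowering C i u)^* = (i == j)%:R * lowering C i u.
  by rewrite rmorphM rmorph_nat /= (admissible_lowering_conj _ _ adm).
rewrite PE ipDl ipXl ipNl ipDl ip_suml ipCl lowering_conj IHu.
under [\sum_k _]eq_bigr => k _ do rewrite ipCl (admissible_herm _ _ _ adm) IHk.
case: v => [|l v].
  rewrite P1 IHj big1 ?oppr0 ?add0r => [|k _]; last by rewrite mul0r mulr0.
  rewrite !eqseq_cons /= mul0r [j == i]eq_sym.
  case: eqP => [<-|_] /=; last by rewrite !mul0r subrr.
  by case: (u == [::]) => /=; rewrite ?mul0r ?mulr0 ?subrr // !mul1r subrr.
have S1 : ip (P (j :: u)) (\sum_k cst (T i k l) * P (k :: v)) =
    T i j l * ((u == v)%:R * weight C (j :: u)).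
  rewrite ip_sumr (bigD1 j) //= big1 ?addr0 => [|k kj].
    by rewrite ipCr IHj eqseq_cons eqxx.
  by rewrite ipCr IHj eqseq_cons eq_sym (negPf kj) mul0r mulr0.
have S2 : \sum_k T i j k * ((k :: u == l :: v)%:R * weight C (k :: u)) =
    T i j l * ((u == v)%:R * weight C (l :: u)).
  rewrite (bigD1 l) //= big1 ?addr0 => [|k kl]; first by rewrite eqseq_cons eqxx.
  by rewrite eqseq_cons (negPf kl) mul0r mulr0.
have S12 : T i j l * ((u == v)%:R * weight C (j :: u)) =
    T i j l * ((u == v)%:R * weight C (l :: u)).
  rewrite /= mulrCA [RHS]mulrCA; congr (_ * _).
  by rewrite !mulrA (admissible_lowering_comm _ _ _ _ adm).
have E1 : (j :: u == [:: i, l & v])%:R * weight C (j :: u) =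
    (i == j)%:R * lowering C i u * ((u == l :: v)%:R * weight C u).
  rewrite eqseq_cons [j == i]eq_sym; case: eqP => [->|_]; rewrite ?mul0r //=.
  by rewrite mul1r mulrCA.
have E3 : (i == l)%:R * lowering C i v * ((j :: u == v)%:R * weight C (j :: u)) =
    ([:: i, j & u] == l :: v)%:R * weight C [:: i, j & u].
  rewrite eqseq_cons; case: (eqVneq (j :: u) v) => [<-|_].
    by rewrite andbT mul1r -mulrA.
  by rewrite andbF !mul0r mulr0.
rewrite Prec !ipDr S1 ipCr !IHj S2 S12 E1 E3.
by rewrite [X in X + _ - _]addrC [X in X - _]addrC addrK.
Qed.

Lemma monic_recursion_mops C T P : admissible C T -> monic_recursion C T P ->
  (forall u, u != [::] -> phi (P u) = 0) -> mops P.
Proof.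
move=> adm Prec Pphi; split=> [||u v uv]; first exact: monic_recursion_monic Prec.
  by case: Prec.
by rewrite (monic_recursion_orthogonal adm) // (negPf uv) mul0r.
Qed.

End Recursion.

(** * Generating functions of resolvent form *)

Lemma psinv_unique (d : nat) (A : nzRingType) (f g : ncps d A) :
  f [::] = 1 -> f * g = 1 -> psinv f = g.
Proof.
by move=> f1 fg; case: (psinvP f1) => _ gf; rewrite -[LHS]mulr1 -fg mulrA gf mul1r.
Qed.

Lemma psC_X_comm (d : nat) (A : nzRingType) (a : A) (i : 'I_d) :
  psC d a * psX A i = psX A i * psC d a.
Proof. by apply/ncpsP => u; rewrite pscoefCM pscoefMC /= mulr_natl mulr_natr. Qed.

Lemma pscoefM1 (d : nat) (A : nzRingType) (f g : ncps d A) (k : 'I_d) :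
  f [::] = 0 -> (f * g) [:: k] = f [:: k] * g [::].
Proof. by move=> f0; rewrite pscoefM big_ord_recl big_ord1 /= f0 mul0r add0r. Qed.

Lemma psX_coef0 (d : nat) (A : nzRingType) (i : 'I_d) : psX A i [::] = 0.
Proof. by []. Qed.

(** The shape common to the right-hand sides of the quadratic equations for
    eta and for R and to the series N_ij. *)
Lemma pssubst_quadratic (K : numClosedFieldType) (d : nat) (V f : 'I_d -> ncps d K)
    (g h : ncps d K) (b : bool) (B : 'I_d -> K) (c : K) :
  (forall i, V i [::] = 0) ->
  pssubst (b%:R + \sum_k psC d (B k) * f k + psC d c * g * h) V =
  b%:R + \sum_k psC d (B k) * pssubst (f k) V
  + psC d c * pssubst g V * pssubst h V.
Proof.
move=> V0; rewrite !(pssubstD V0) !(pssubstM V0) pssubstC // pssubst_sumM //.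
congr (_ + _ + _).
  by case: b; rewrite ?pssubst1 // pssubst0.
by apply: eq_bigr => k _; rewrite pssubstC.
Qed.

Section GeneratingFunctions.
Variables (K : numClosedFieldType) (d : nat) (W : word_algebra K d).
Implicit Types (p q : W) (u v : seq 'I_d) (i j k : 'I_d) (a : K).
Implicit Types (C : 'M[K]_(d * d)) (T : 'I_d -> 'M[K]_d).
Implicit Types (f g : ncps d K) (F : ncps d W) (U V : 'I_d -> ncps d K).
Local Notation cst := (cst W).
Local Notation var := (@var _ _ W).
Local Notation adj := (@adj _ _ W).
Local Notation mon := (@mon _ _ W).

(** Scalar series seen with coefficients in the algebra. *)
Definition cst_ps f : ncps d W := psmap cst f.

Fact cst_ps_is_zmod_morphism : zmod_morphism cst_ps.
Proof. by move=> f g; apply/ncpsP => u; rewrite /= rmorphB. Qed.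
HB.instance Definition _ :=
  GRing.isZmodMorphism.Build (ncps d K) (ncps d W) cst_ps cst_ps_is_zmod_morphism.

Fact cst_ps_is_monoid_morphism : monoid_morphism cst_ps.
Proof.
split=> [|f g]; apply/ncpsP => u; first by rewrite /= rmorphMn rmorph1.
rewrite /= rmorph_sum; apply: eq_bigr => k _; exact: rmorphM.
Qed.
HB.instance Definition _ :=
  GRing.isMonoidMorphism.Build (ncps d K) (ncps d W) cst_ps cst_ps_is_monoid_morphism.

Lemma cst_psM f g : cst_ps (f * g) = cst_ps f * cst_ps g.
Proof. exact: rmorphM. Qed.

Lemma cst_psD f g : cst_ps (f + g) = cst_ps f + cst_ps g.
Proof. exact: rmorphD. Qed.

Lemma cst_ps_sum (J : Type) (s : seq J) (G : J -> ncps d K) :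
  cst_ps (\sum_(t <- s) G t) = \sum_(t <- s) cst_ps (G t).
Proof. exact: rmorph_sum. Qed.

Lemma cst_psC a : cst_ps (psC d a) = psC d (cst a).
Proof. by apply/ncpsP => u; rewrite /= rmorphMn. Qed.

Lemma cst_psX i : cst_ps (psX K i) = psX W i.
Proof. by apply/ncpsP => u; rewrite /= rmorph_nat. Qed.

Lemma cst_ps_comm p f : psC d p * cst_ps f = cst_ps f * psC d p.
Proof. by apply/ncpsP => u; rewrite pscoefCM pscoefMC /= cst_comm. Qed.

Definition dot_var V : ncps d W := \sum_i psC d (var i) * cst_ps (V i).

Lemma dot_varM V F : dot_var V * F = \sum_i cst_ps (V i) * (psC d (var i) * F).
Proof. by rewrite mulr_suml; apply: eq_bigr => i _; rewrite cst_ps_comm mulrA. Qed.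

Lemma dot_var0 V : (forall i, V i [::] = 0) -> dot_var V [::] = 0.
Proof.
move=> V0; rewrite pscoef_sum big1 // => i _.
by rewrite pscoefCM /= V0 rmorph0 mulr0.
Qed.

Lemma resolventP V : (forall i, V i [::] = 0) ->
  (1 - dot_var V) * psinv (1 - dot_var V) = 1 /\
  psinv (1 - dot_var V) * (1 - dot_var V) = 1.
Proof.
by move=> V0; apply: psinvP; rewrite pscoefD pscoefN dot_var0 // subr0 pscoef1.
Qed.

Lemma resolvent_eq V F g : (forall i, V i [::] = 0) ->
  F = psinv (1 - dot_var V) * (1 - cst_ps g) <-> F = 1 - cst_ps g + dot_var V * F.
Proof.
move=> /resolventP[inv1 inv2]; split=> [->|FE].
  apply/eqP; rewrite -subr_eq -{1}[psinv _ * _]mul1r -mulrBl mulrA inv1 mul1r.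
  exact: eqxx.
have -> : 1 - cst_ps g = (1 - dot_var V) * F by rewrite mulrBl mul1r {1}FE addrK.
by rewrite mulrA inv2 mul1r.
Qed.

Variable phi : W -> K.
Hypothesis phi_lin : forall a p q, phi (cst a * p + q) = a * phi p + phi q.
Hypothesis phi1 : phi 1 = 1.
Local Notation phiD := (phiD phi_lin).
Local Notation phiC := (phiC phi_lin).
Local Notation phi0 := (phi0 phi_lin).
Local Notation phiB := (phiB phi_lin).
Local Notation phi_sum := (phi_sum phi_lin).

Definition phiS F : ncps d K := psmap phi F.

Lemma phiSD F F' : phiS (F + F') = phiS F + phiS F'.
Proof. by apply/ncpsP => u; rewrite /= phiD. Qed.

Lemma phiS0 : phiS 0 = 0.
Proof. by apply/ncpsP => u; rewrite pscoef0 /= mul0rn phi0. Qed.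

Lemma phiS_sum (J : Type) (r : seq J) (F : J -> ncps d W) :
  phiS (\sum_(t <- r) F t) = \sum_(t <- r) phiS (F t).
Proof. exact: (big_morph _ phiSD phiS0). Qed.

Lemma phiSC p : phiS (psC d p) = psC d (phi p).
Proof. by apply/ncpsP => u /=; case: (u == [::]); rewrite ?mulr1n ?mulr0n ?phi0. Qed.

Lemma phiS_cstl f F : phiS (cst_ps f * F) = f * phiS F.
Proof.
by apply/ncpsP => u; rewrite /= phi_sum; apply: eq_bigr => k _; rewrite phiC.
Qed.

Lemma phiS_cstr f F : phiS (F * cst_ps f) = phiS F * f.
Proof.
apply/ncpsP => u; rewrite /= phi_sum; apply: eq_bigr => k _.
by rewrite -cst_comm phiC mulrC.
Qed.

(** The resolvent is G = 1 + sum_i V_i x_i G, so that phi(p G) =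
    phi(p) + sum_i V_i phi(p x_i G); the series with coefficients
    phi(p x_u), evaluated at V, satisfies the same system in p. *)
Lemma phi_resolvent V p : (forall i, V i [::] = 0) ->
  phiS (psC d p * psinv (1 - dot_var V)) = pssubst (NCPS (fun u => phi (p * mon u))) V.
Proof.
move=> V0; move: p; apply: (left_linear_system_unique V0 (c := fun p => psC d (phi p))
  (s := fun i p => p * var i)) => p.
  have {1}-> : psinv (1 - dot_var V) = 1 + dot_var V * psinv (1 - dot_var V).
    by apply/eqP; rewrite -subr_eq -{1}[psinv _]mul1r -mulrBl (resolventP V0).1.
  rewrite mulrDr mulr1 dot_varM mulr_sumr phiSD phiSC phiS_sum; congr (_ + _).
  apply: eq_bigr => i _; rewrite mulrA cst_ps_comm -mulrA phiS_cstl mulrA.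
  by rewrite -rmorphM.
rewrite pssubst_split //= mon_nil mulr1; congr (_ + _); apply: eq_bigr => i _.
by congr (_ * pssubst _ _); apply/ncpsP => u; rewrite /= mon_cons mulrA.
Qed.

Definition moments : ncps d K := NCPS (fun u => phi (mon u)).
Local Notation m := moments.

Lemma moments0 : m [::] = 1.
Proof. by rewrite /= mon_nil. Qed.

Lemma phi_resolvent1 V : (forall i, V i [::] = 0) ->
  phiS (psinv (1 - dot_var V)) = pssubst m V.
Proof.
move=> V0; rewrite -[psinv _]mul1r -[1](rmorph1 (@psC d W)) phi_resolvent //.
by congr pssubst; apply/ncpsP => u; rewrite /= mul1r.
Qed.

Lemma phi_resolventX V i : (forall i, V i [::] = 0) ->
  phiS (psC d (var i) * psinv (1 - dot_var V)) = pssubst (psD i m) V.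
Proof.
move=> V0; rewrite phi_resolvent //.
by congr pssubst; apply/ncpsP => u; rewrite /= mon_cons.
Qed.

Variables (e r : ncps d K).
Hypotheses (e0 : e [::] = 0) (r0 : r [::] = 0).
Hypothesis mE : m = 1 + m * e.
Hypothesis mR : m = 1 + pssubst r (fun i => m * psX K i).
Hypothesis mean0 : forall i, phi (var i) = 0.
Hypothesis cov1 : forall i j, phi (var i * var j) = (i == j)%:R.

Lemma moments_inv : m * (1 - e) = 1 /\ (1 - e) * m = 1.
Proof.
have m1e : m * (1 - e) = 1 by rewrite mulrBr mulr1 {1}mE addrK.
split=> //; have [_ nm] := psinvP moments0.
suff -> : 1 - e = psinv m by [].
transitivity (psinv m * m * (1 - e)); first by rewrite nm mul1r.
by rewrite -mulrA m1e mulr1.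
Qed.

Lemma moments_eq_left : m = 1 + e * m.
Proof. by apply/eqP; rewrite -subr_eq -{1}[m]mul1r -mulrBl moments_inv.2. Qed.

Lemma psD_moments i : psD i m = psD i e * m.
Proof.
rewrite {1}moments_eq_left raddfD /= psD_M e0 raddf0 mul0r add0r.
by rewrite -[1](rmorph1 (@psC d K)) psD_C add0r.
Qed.

Lemma e_coef1 i : e [:: i] = 0.
Proof.
have /ncpsP/(_ [::]) := psD_moments i.
by rewrite pscoefM0 moments0 mulr1 /= mon_cons mon_nil mulr1 mean0.
Qed.

Lemma e_coef2 i j : e [:: i; j] = (i == j)%:R.
Proof.
have /ncpsP/(_ [:: j]) := psD_moments i.
rewrite pscoefM big_ord_recr big_ord1 /= e_coef1 mul0r add0r mon_nil phi1 mulr1 => <-.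
by rewrite !mon_cons mon_nil mulr1 cov1.
Qed.

Section Subst.
Variable V : 'I_d -> ncps d K.
Hypothesis V0 : forall i, V i [::] = 0.

Definition boolean_gf : ncps d W := psinv (1 - dot_var V) * (1 - cst_ps (pssubst e V)).

Lemma subst_inv : pssubst m V * (1 - pssubst e V) = 1 /\
  (1 - pssubst e V) * pssubst m V = 1.
Proof.
by rewrite -(pssubst1 V0) -pssubstB // -!pssubstM // moments_inv.1 moments_inv.2.
Qed.

(** phi(x_i G) = (D_i m)(V) = (D_i e)(V) m(V), and the factor 1 - e(V) of the
    generating function cancels m(V). *)
Lemma phi_var_boolean_gf i : phiS (psC d (var i) * boolean_gf) = pssubst (psD i e) V.
Proof.
rewrite /boolean_gf mulrA -[1 in X in _ * X](rmorph1 cst_ps) -rmorphB.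
rewrite phiS_cstr phi_resolventX //.
by rewrite psD_moments pssubstM // -mulrA subst_inv.1 mulr1.
Qed.

(** Orthogonality to P_i = x_i makes phi(x_i P_u) vanish except for u = i,
    where it is 1; so phi(x_i H) = z_i, whereas it is (D_i e)(V) in
    general. *)
Lemma boolean_gf_mops_inverse i : mops phi boolean_gf -> pssubst (psD i e) V = psX K i.
Proof.
move=> mP; rewrite -phi_var_boolean_gf; apply/ncpsP => u.
rewrite -[LHS]/(phi ((psC d (var i) * boolean_gf) u)) pscoefCM.
(* Polynomials of degree 0 are constants. *)
have below1 p : below 1 p -> p = cst (phi p).
  apply: (@below_ind _ _ W mon (fun p => p = cst (phi p))).
  - by move=> v; rewrite -/(mon v) subrr; apply: below0_eq.
  - by rewrite /= phi0 rmorph0.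
  - by move=> q q' qE qE'; rewrite phiD rmorphD -qE -qE'.
  - by move=> a q qE; rewrite phiC rmorphM -qE.
  - by case=> // _; rewrite mon_nil phi1 rmorph1.
have PX j : boolean_gf [:: j] = var j.
  case: (mP) => /(_ [:: j]) /below1 + _ _; rewrite phiB (mops_phi mP) //.
  rewrite mon_cons mon_nil mulr1 mean0 subrr rmorph0 => /eqP.
  by rewrite subr_eq0 => /eqP.
have -> : phi (var i * boolean_gf u) = ip phi (boolean_gf [:: i]) (boolean_gf u).
  by rewrite PX /ip adjX.
case: (mP) => _ _ orth; rewrite -[RHS]/((u == [:: i])%:R).
case: (eqVneq u [:: i]) => [->|ui].
  by rewrite PX /ip adjX cov1 eqxx.
by rewrite orth // eq_sym.
Qed.

End Subst.

(** The first Boolean condition without the requirement that V be the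
    compositional inverse of D eta, which orthogonality implies; this is the
    form to which the resolvent condition on R reduces. *)
Definition resolvent_cond :=
  exists V, (forall i, V i [::] = 0) /\ mops phi (boolean_gf V).

Definition boolean_gf_cond := exists V : 'I_d -> ncps d K,
    [/\ forall i, V i [::] = 0,
        forall i, pssubst (psD i e) V = psX K i &
        mops phi (boolean_gf V)].

Definition boolean_pde_cond := exists C T, admissible C T /\
    forall i j, psD i (psD j e) =
      (i == j)%:R + \sum_k psC d (T i j k) * psD k e
      + psC d (1 + diag2 C i j) * psD i e * psD j e.

Definition free_gf_cond := exists U : 'I_d -> ncps d K,
    (forall i, U i [::] = 0) /\ mops phi (psinv (1 - dot_var U + cst_ps (pssubst r U))).

Definition free_pde_cond := exists C T, admissible C T /\
    forall i j, psD i (psD j r) =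
      (i == j)%:R + \sum_k psC d (T i j k) * psD k r
      + psC d (diag2 C i j) * psD i r * psD j r.

Definition recursion_cond := exists C T, admissible C T /\
  exists P : seq 'I_d -> W, monic_recursion C T P /\
    forall u, u != [::] -> phi (P u) = 0.

Let w i : ncps d K := m * psX K i.

Let w0 i : w i [::] = 0.
Proof. by rewrite pscoefM0 /= mulr0. Qed.

Let w1 i k : w i [:: k] = (i == k)%:R.
Proof.
by rewrite /w (coef_mulX _ _ _).2 moments0 mul1r.
Qed.

(** Both m - 1 = sum_i w_i (D_i r)(w) and m - 1 = sum_i w_i D_i e, with
    w_i = m z_i, and the w_i are left-independent. *)
Lemma free_boolean_D i : pssubst (psD i r) w = psD i e.
Proof.
apply/eqP; rewrite -subr_eq0; apply/eqP; move: i.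
apply: (left_independent w0 w1); rewrite (eq_bigr (fun i =>
  w i * pssubst (psD i r) w - w i * psD i e)) => [|i _]; last exact: mulrBr.
rewrite sumrB.
have -> : \sum_i w i * pssubst (psD i r) w = m - 1.
  by rewrite {1}mR (pssubst_split r) // r0 raddf0 add0r addrAC subrr add0r.
have -> : \sum_i w i * psD i e = m * e.
  rewrite {2}(ps_split e) e0 raddf0 add0r mulr_sumr.
  by apply: eq_bigr => i _; rewrite mulrA.
by rewrite {1}mE addrAC addrK subrr.
Qed.

(** Expanding both sides of (D_j r)(m z) = D_j e along first letters, and
    multiplying by m^(-1) = 1 - e on the left. *)
Lemma free_boolean_DD i j :
  pssubst (psD i (psD j r)) w = psD i (psD j e) - psD i e * psD j e.
Proof.
have ej0 : psD j e [::] = 0 by exact: e_coef1.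
have rj0 : psD j r [::] = 0 by rewrite -(pssubst_coef0 w0) free_boolean_D.
have H : (1 - e) * psD j e = \sum_i psX K i * pssubst (psD i (psD j r)) w.
  rewrite -free_boolean_D (pssubst_split (psD j r)) // rj0 raddf0 add0r mulr_sumr.
  by apply: eq_bigr => k _; rewrite 2!mulrA moments_inv.2 mul1r.
suff -> : psD i (psD j e) - psD i e * psD j e = psD i ((1 - e) * psD j e).
  by rewrite H; apply/ncpsP => u; rewrite /= coef_sumX.
by rewrite mulrBl mul1r raddfB /= psD_M e0 raddf0 mul0r add0r.
Qed.

Lemma free_boolean_pde (B : 'I_d -> K) (c : K) i j :
  psD i (psD j e) = (i == j)%:R + \sum_k psC d (B k) * psD k e
      + psC d (1 + c) * psD i e * psD j e <->
  psD i (psD j r) = (i == j)%:R + \sum_k psC d (B k) * psD k r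
      + psC d c * psD i r * psD j r.
Proof.
pose rhs := (i == j)%:R + \sum_k psC d (B k) * psD k r + psC d c * psD i r * psD j r.
have rhsE : pssubst rhs w = (i == j)%:R + \sum_k psC d (B k) * psD k e
      + psC d c * psD i e * psD j e.
  rewrite pssubst_quadratic // !free_boolean_D.
  by under eq_bigr => k _ do rewrite free_boolean_D.
have sumE : (i == j)%:R + \sum_k psC d (B k) * psD k e
      + psC d (1 + c) * psD i e * psD j e = pssubst rhs w + psD i e * psD j e.
  by rewrite rhsE rmorphD rmorph1 !mulrDl mul1r -[RHS]addrA [_ * _ + _ in RHS]addrC.
rewrite sumE -/rhs; split=> [E|E].
  by apply: (pssubst_inj w0 w1); rewrite free_boolean_DD E addrK.
by rewrite -E free_boolean_DD subrK.
Qed.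

Lemma boolean_free_pde_condP : boolean_pde_cond <-> free_pde_cond.
Proof.
by split=> -[C [T [adm H]]]; exists C, T; split=> // i j; apply/free_boolean_pde/H.
Qed.

Lemma pssubst_moments_fixpoint V : (forall i, V i [::] = 0) ->
  pssubst m V = 1 + pssubst r (fun i => pssubst m V * V i).
Proof.
move=> V0; rewrite {1}mR pssubstD // pssubst1 //; congr (_ + _).
rewrite pssubst_comp //; congr pssubst; apply: functional_extensionality_dep => i.
by rewrite pssubstM // pssubstX.
Qed.

(** The substitution V in m = 1 + r(m z) gives 1 + r(U) = m(V), whence
    1 - x.U + r(U) = m(V) (1 - x.V). *)
Lemma free_gf_eq_boolean_gf V U : (forall i, V i [::] = 0) ->
  (forall i, U i = pssubst m V * V i) ->
  psinv (1 - dot_var U + cst_ps (pssubst r U)) = boolean_gf V.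
Proof.
move=> V0 UE; have mV := pssubst_moments_fixpoint V0.
have rU : 1 + pssubst r U = pssubst m V.
  by rewrite [RHS]mV; congr (_ + pssubst _ _); apply: functional_extensionality_dep.
have U0 i : U i [::] = 0 by rewrite UE pscoefM0 V0 mulr0.
have -> : 1 - dot_var U + cst_ps (pssubst r U) = cst_ps (pssubst m V) * (1 - dot_var V).
  rewrite -rU addrAC -[1 in LHS](rmorph1 cst_ps) -rmorphD rU mulrBr mulr1; congr (_ - _).
  rewrite mulr_sumr; apply: eq_bigr => i _.
  by rewrite UE cst_psM mulrA cst_ps_comm -mulrA.
apply: psinv_unique.
  rewrite pscoefM0 pscoefD pscoefN dot_var0 // subr0 pscoef1 mulr1.
  by rewrite -[LHS]/(cst _) pssubst_coef0 // moments0 rmorph1.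
rewrite /boolean_gf mulrA -[_ * (1 - _) * _]mulrA (resolventP V0).1 mulr1.
by rewrite -[1 in X in _ * X](rmorph1 cst_ps) -rmorphB -rmorphM (subst_inv V0).1 rmorph1.
Qed.

Lemma agree_prod (J : Type) (s : seq J) n (F G : J -> ncps d K) :
  (forall t, agree n (F t) (G t)) -> agree n (\prod_(t <- s) F t) (\prod_(t <- s) G t).
Proof.
by move=> FG; elim: s => [|t s IH]; rewrite ?big_nil // !big_cons; apply: agreeM.
Qed.

Lemma agree_pssubst n f U U' :
  (forall i, agree n (U i) (U' i)) -> agree n (pssubst f U) (pssubst f U').
Proof.
move=> UU u un; apply: eq_bigr => k _; apply: eq_bigr => v _.
by congr (_ * _); exact: (agree_prod v UU).
Qed.

(** A given U is of the form m(V) V: with Q = 1 + r(U) and V = Q^(-1) U, both Q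
    and m(V) solve q = 1 + r(q V), which has only one solution. *)
Lemma free_gf_condP : free_gf_cond <-> resolvent_cond.
Proof.
split=> [[U [U0 mU]]|[V [V0 mV]]]; last first.
  exists (fun i => pssubst m V * V i); rewrite (free_gf_eq_boolean_gf V0) //; split=> // i.
  by rewrite pscoefM0 V0 mulr0.
(* Q plays the role of m(V). *)
pose Q := 1 + pssubst r U; have Q0 : Q [::] = 1.
  by rewrite pscoefD pssubst_coef0 // r0 addr0 pscoef1.
have [QV _] := psinvP Q0; pose V i := psinv Q * U i.
have V0 i : V i [::] = 0 by rewrite pscoefM0 U0 mulr0.
have UE i : U i = Q * V i by rewrite mulrA QV mul1r.
have QE : pssubst m V = Q.
  apply: (ps_eq_by_contraction (X := fun _ : unit => pssubst m V) (Y := fun=> Q) _ tt).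
  move=> n IH t; rewrite (pssubst_moments_fixpoint V0) /Q.
  apply: agreeD => //; apply: agree_pssubst => i; rewrite UE.
  exact: agree_mul0r (IH tt).
exists V; split=> //.
by rewrite -(free_gf_eq_boolean_gf V0 (U := U)) // => i; rewrite QE UE.
Qed.

(** The series N_ij, which will be (D_i D_j eta)(V). *)
Definition quad_series C T i j : ncps d K :=
  (i == j)%:R + \sum_k psC d (T i j k) * psX K k
  + psC d (1 + diag2 C i j) * psX K i * psX K j.

(** The system is V_j = z_j - sum_i V_i (N_ij - delta_ij), a contraction since
    N_ij - delta_ij has no constant term. *)
Lemma exists_left_inverse C T : exists V : 'I_d -> ncps d K,
  (forall i, V i [::] = 0) /\ forall j, \sum_i V i * quad_series C T i j = psX K j.
Proof.
pose E i j := quad_series C T i j - (i == j)%:R.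
have E0 i j : E i j [::] = 0.
  rewrite /E /quad_series -[X in X - _]addrA [X in X - _]addrC addrK pscoefD pscoef_sum.
  rewrite pscoefM0 psX_coef0 mulr0 addr0 big1 // => k _.
  by rewrite pscoefM0 psX_coef0 mulr0.
have [n X Y XY j|V VE] := @contraction_fixpoint d K 'I_d
    (fun V j => psX K j - \sum_i V i * E i j).
  apply: agreeD => //; apply: agreeN; apply: agree_sum => i.
  exact: agree_mul0r.
have V0 i : V i [::] = 0.
  rewrite VE pscoefD pscoefN pscoef_sum big1 ?subr0 // => j _.
  by rewrite pscoefM0 E0 mulr0.
exists V; split=> // j.
have quadE i : quad_series C T i j = (i == j)%:R + E i j by rewrite addrC subrK.
under eq_bigr => i _ do rewrite quadE mulrDr.
rewrite big_split /= (bigD1 j) //= eqxx mulr1 big1 => [|i ij].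
  by rewrite addr0 {1}VE subrK.
by rewrite (negPf ij) mulr0.
Qed.

(** The constant, linear and quadratic parts of N_ij produce the creation, T_i
    and annihilation parts of the recursion; the case of an empty u in the
    latter is the term z_i on the left. *)
Lemma gf_recursion C T (P : seq 'I_d -> W) : monic_recursion C T P ->
  forall i, psC d (var i) * NCPS P - psX W i =
            \sum_j cst_ps (quad_series C T i j) * psD j (NCPS P).
Proof.
move=> [P0 P1 Prec] i; set F := NCPS P.
have serE j : cst_ps (quad_series C T i j) * psD j F =
    (i == j)%:R * psD j F
    + \sum_k psX W k * (psC d (cst (T i j k)) * psD j F)
    + psX W i * (psX W j * (psC d (cst (1 + diag2 C i j)) * psD j F)).
  rewrite /quad_series !cst_psD cst_ps_sum !mulrDl mulr_suml (rmorph_nat cst_ps).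
  rewrite cst_psM cst_psM cst_psC !cst_psX; congr (_ + _ + _).
    by apply: eq_bigr => k _; rewrite cst_psM cst_psC cst_psX psC_X_comm mulrA.
  by rewrite psC_X_comm -!mulrA; congr (_ * _); rewrite !mulrA psC_X_comm.
under [RHS]eq_bigr => j _ do rewrite serE.
rewrite 2!big_split /= exchange_big /=.
have -> : \sum_j (i == j)%:R * psD j F = psD i F.
  rewrite (bigD1 i) //= eqxx mul1r big1 ?addr0 // => j ji.
  by rewrite eq_sym (negPf ji) mul0r.
have -> : \sum_k \sum_j psX W k * (psC d (cst (T i j k)) * psD j F) =
    \sum_k psX W k * \sum_j psC d (cst (T i j k)) * psD j F.
  by apply: eq_bigr => k _; rewrite mulr_sumr.
rewrite -mulr_sumr; apply/ncpsP => -[|k u].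
  rewrite !pscoefD pscoefN pscoefCM coef_sumX0 pscoefM0 /= mul0r !addr0 subr0.
  exact: P1.
rewrite !pscoefD pscoefN pscoefCM coef_sumX pscoef_sum.
have -> : (psX W i * \sum_j psX W j * (psC d (cst (1 + diag2 C i j)) * psD j F)) (k :: u)
    = (i == k)%:R * (\sum_j psX W j * (psC d (cst (1 + diag2 C i j)) * psD j F)) u.
  set S := \sum_j _; rewrite -[LHS]/(psD k (psX W i * S) u) psD_XM eq_sym.
  by case: (i == k); rewrite ?mul1r // !mul0r pscoef0.
rewrite -[F (k :: u)]/(P (k :: u)) Prec -[psD i F _]/(P [:: i, k & u]).
rewrite -[LHS]addrA; congr (_ + _ + _).
  by apply: eq_bigr => j _; rewrite pscoefCM.
rewrite rmorphM rmorph_nat /= eqseq_cons [k == i]eq_sym.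
case: (i == k); last by rewrite !mul0r subr0.
rewrite !mul1r; case: u => [|j u] /=; first by rewrite coef_sumX0 rmorph1 mul1r P0 subrr.
by rewrite coef_sumX pscoefCM subr0.
Qed.

Lemma gf_resolvent C T (P : seq 'I_d -> W) V : monic_recursion C T P ->
  (forall i, V i [::] = 0) -> (forall j, \sum_i V i * quad_series C T i j = psX K j) ->
  NCPS P = psinv (1 - dot_var V) * (1 - cst_ps (\sum_i V i * psX K i)).
Proof.
move=> Prec V0 VE; have HF := gf_recursion Prec; case: Prec => P0 _ _.
apply/resolvent_eq => //; set F := NCPS P.
have H : F = 1 + \sum_j psX W j * psD j F.
  rewrite {1}(ps_split F); congr (_ + _).
  by rewrite -[F [::]]/(P [::]) P0 rmorph1.
have H2 : \sum_j psX W j * psD j F =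
    \sum_i cst_ps (V i) * (psC d (var i) * F - psX W i).
  transitivity (\sum_j \sum_i cst_ps (V i) * (cst_ps (quad_series C T i j) * psD j F)).
    apply: eq_bigr => j _; rewrite -cst_psX -VE cst_ps_sum mulr_suml.
    by apply: eq_bigr => i _; rewrite cst_psM mulrA.
  by rewrite exchange_big; apply: eq_bigr => i _; rewrite HF mulr_sumr.
rewrite {1}H H2 (eq_bigr (fun i =>
  cst_ps (V i) * (psC d (var i) * F) - cst_ps (V i * psX K i)))
  => [|i _]; last by rewrite mulrBr cst_psM cst_psX.
by rewrite sumrB -dot_varM -cst_ps_sum addrA addrAC.
Qed.

(** The tuples ((D_j e)(V))_j and z solve the same contracting system
    y_j = sum_i V_i N_ij(y): the former by the quadratic equations, the latter
    by the choice of V.  Hence sum_i V_i z_i = e(V), and phi(H) = 1. *)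
Lemma boolean_pde_imp_recursion : boolean_pde_cond -> recursion_cond.
Proof.
move=> [C [T [adm eE]]]; have [V [V0 VE]] := exists_left_inverse C T.
exists C, T; split=> //; exists (rec_poly W C T); split; first exact: rec_polyP.
have gfE := gf_resolvent (@rec_polyP _ _ W C T) V0 VE.
set P := rec_poly W C T in gfE *.
have DeV : forall j, pssubst (psD j e) V = psX K j.
  apply: ps_eq_by_contraction => n IH j; rewrite -VE (pssubst_split (psD j e)) //.
  rewrite -[psD j e [::]]/(e [:: j]) e_coef1 raddf0 add0r.
  apply: agree_sum => i; apply: agree_mul0l => //.
  rewrite eE pssubst_quadratic //; apply: agreeD; first apply: agreeD => //.
    by apply: agree_sum => k; apply: agreeM.
  by apply: agreeM => //; apply: agreeM.
have phiP : phiS (NCPS P) = 1.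
  rewrite gfE -[1 in X in _ * X](rmorph1 cst_ps) -rmorphB phiS_cstr phi_resolvent1 //.
  apply: etrans (subst_inv V0).1; congr (_ * (_ - _)).
  rewrite (pssubst_split e) // e0 raddf0 add0r.
  by apply: eq_bigr => i _; rewrite DeV.
move=> u u0; have /ncpsP/(_ u) := phiP; rewrite /= => ->.
by rewrite (negPf u0).
Qed.

(** phi(H) = 1 says m(V) (1 - sum_i V_i z_i) = 1, and (1 - e(V)) m(V) = 1, so
    that H has the numerator 1 - e(V). *)
Lemma recursion_boolean_gf : recursion_cond -> resolvent_cond.
Proof.
move=> [C [T [adm [P [Prec Pphi]]]]]; have [V [V0 VE]] := exists_left_inverse C T.
exists V; split=> //; have gfE := gf_resolvent Prec V0 VE.
have phiP : phiS (NCPS P) = 1.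
  apply/ncpsP => u; rewrite pscoef1 /=; have [->|/Pphi//] := eqVneq u [::].
  by case: Prec => ->.
suff -> : boolean_gf V = NCPS P by apply: monic_recursion_mops adm Prec Pphi.
rewrite gfE /boolean_gf; congr (_ * (_ - cst_ps _)).
move: phiP; rewrite gfE -[1 in X in _ * X](rmorph1 cst_ps) -rmorphB phiS_cstr.
rewrite phi_resolvent1 //; set s := \sum_i _ => mVs.
have /addrI/oppr_inj/esym// : 1 - s = 1 - pssubst e V.
transitivity ((1 - pssubst e V) * (pssubst m V * (1 - s))); last by rewrite mVs mulr1.
by rewrite mulrA (subst_inv V0).2 mul1r.
Qed.

Lemma boolean_gf_condP : resolvent_cond <-> boolean_gf_cond.
Proof.
split=> [[V [V0 mV]]|[V [V0 _ mV]]]; exists V => //.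
by split=> // i; apply: boolean_gf_mops_inverse.
Qed.

(** * From orthogonality to the quadratic equations *)

Section Necessity.
Hypothesis phi_adj : forall p, phi (adj p) = (phi p)^*.
Hypothesis phi_ge0 : forall p, 0 <= phi (adj p * p).
Local Notation ip := (ip phi).

Lemma ip_conj p q : ip p q = (ip q p)^*.
Proof. by rewrite /ip -phi_adj adjM adjK. Qed.

Lemma psXX_coef i j u : (psX K i * psX K j) u = (u == [:: i; j])%:R.
Proof.
case: u => [|k u]; first by rewrite pscoefM0 mul0r.
rewrite -[LHS]/(psD k _ u) psD_XM eqseq_cons.
by case: (k == i); rewrite ?mul1r // mul0r pscoef0.
Qed.

Lemma quad_series_coef C T i j u : quad_series C T i j u =
  (i == j)%:R * (u == [::])%:R + \sum_k T i j k * (u == [:: k])%:R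
  + (1 + diag2 C i j) * (u == [:: i; j])%:R.
Proof.
rewrite /quad_series !pscoefD pscoef_sum -mulrA pscoefCM psXX_coef; congr (_ + _ + _).
  by case: (i == j); rewrite ?pscoef1 ?mul1r // pscoef0 mul0r.
by apply: eq_bigr => k _; rewrite pscoefCM.
Qed.

Section FromMOPS.
Variable V : 'I_d -> ncps d K.
Hypotheses (V0 : forall i, V i [::] = 0)
  (VX : forall i, pssubst (psD i e) V = psX K i) (mV : mops phi (boolean_gf V)).
Let H := boolean_gf V.
Let N i j := pssubst (psD i (psD j e)) V.
Let nrm u := ip (H u) (H u).

Let VN j : \sum_i V i * N i j = psX K j.
Proof.
rewrite -VX (pssubst_split (psD j e)) // -[psD j e [::]]/(e [:: j]) e_coef1.
by rewrite raddf0 add0r.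
Qed.

Let N0 i j : N i j [::] = (i == j)%:R.
Proof. by rewrite pssubst_coef0 // -[LHS]/(e [:: j; i]) e_coef2 eq_sym. Qed.

Let V1 i k : V i [:: k] = (i == k)%:R.
Proof.
have /ncpsP/(_ [:: k]) := VN i; rewrite pscoef_sum.
under eq_bigr => j _ do rewrite pscoefM1 // N0.
rewrite (bigD1 i) //= eqxx mulr1 big1 ?addr0 => [->|j ji].
  by rewrite eqseq_cons andbT eq_sym.
by rewrite (negPf ji) mulr0.
Qed.

Let H1 : H [::] = 1. Proof. by case: mV. Qed.

Let orth u v : ip (H u) (H v) = (u == v)%:R * nrm u.
Proof.
case: mV => _ _ ort; case: eqVneq => [->|uv]; first by rewrite mul1r.
by rewrite mul0r ort.
Qed.

Let key i : psC d (var i) * H - psX W i = \sum_j cst_ps (N i j) * psD j H.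
Proof.
apply/eqP; rewrite -subr_eq0; apply/eqP; move: i.
apply: (@left_independent _ _ (fun i => cst_ps (V i))) => [i|i k|].
- by rewrite /= V0 rmorph0.
- by rewrite /= V1 rmorph_nat.
have HE : H = 1 - cst_ps (pssubst e V) + dot_var V * H by apply/resolvent_eq.
have eV : pssubst e V = \sum_i V i * psX K i.
  rewrite (pssubst_split e) // e0 raddf0 add0r.
  by apply: eq_bigr => i _; rewrite VX.
have HX : H = 1 + \sum_j psX W j * psD j H.
  by rewrite {1}(ps_split H) H1 rmorph1.
have S1 : \sum_i cst_ps (V i) * (psC d (var i) * H - psX W i) =
    dot_var V * H - cst_ps (pssubst e V).
  rewrite dot_varM eV cst_ps_sum -sumrB; apply: eq_bigr => i _.
  by rewrite mulrBr cst_psM cst_psX.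
have S2 : \sum_i cst_ps (V i) * (\sum_j cst_ps (N i j) * psD j H) = H - 1.
  rewrite {2}HX addrAC subrr add0r.
  transitivity (\sum_j \sum_i cst_ps (V i) * (cst_ps (N i j) * psD j H)).
    by rewrite exchange_big; apply: eq_bigr => i _; rewrite mulr_sumr.
  apply: eq_bigr => j _; rewrite -cst_psX -VN cst_ps_sum mulr_suml.
  by apply: eq_bigr => i _; rewrite cst_psM mulrA.
under eq_bigr => i _ do rewrite mulrBr.
rewrite sumrB S1 S2.
have -> : H - 1 = dot_var V * H - cst_ps (pssubst e V).
  by rewrite [in LHS]HE addrAC [1 - _]addrC addrK addrC.
by rewrite subrr.
Qed.

Let rec i u : var i * H u - (u == [:: i])%:R =
  \sum_j \sum_(k < (size u).+1) cst (N i j (take k u)) * H (j :: drop k u).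
Proof.
have /ncpsP/(_ u) := key i.
by rewrite pscoefD pscoefN pscoefCM pscoef_sum.
Qed.

Let H_var i : H [:: i] = var i.
Proof.
have E j : \sum_(k < 1) cst (N i j (take k [::])) * H (j :: drop k [::]) =
    (i == j)%:R * H [:: j].
  by rewrite big_ord1 N0 rmorph_nat.
have := rec i [::]; rewrite subr0 H1 mulr1 (eq_bigr _ (fun j _ => E j)) => ->.
rewrite (big_only1 i) // => [|j ji _]; first by rewrite eqxx mul1r.
by rewrite eq_sym (negPf ji) mul0r.
Qed.

Let nrm1 i : nrm [:: i] = 1.
Proof. by rewrite /nrm H_var /ip adjX cov1 eqxx. Qed.

Let ip_rec (a : 'I_d) v i u : ip (H (a :: v)) (var i * H u) =
  \sum_(k < (size u).+1) N i a (take k u) * ((drop k u == v)%:R * nrm (a :: v)).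
Proof.
have -> : var i * H u = cst (u == [:: i])%:R * H [::] +
    \sum_j \sum_(k < (size u).+1) cst (N i j (take k u)) * H (j :: drop k u).
  by rewrite -rec H1 mulr1 rmorph_nat addrC subrK.
rewrite ipDr // ipCr // orth mul0r mulr0 add0r ip_sumr //.
rewrite (big_only1 a) // => [|j ja _]; rewrite ip_sumr //.
  by apply: eq_bigr => k _; rewrite ipCr // orth eqseq_cons eqxx eq_sym.
rewrite big1 // => k _.
by rewrite ipCr // orth eqseq_cons eq_sym (negPf ja) mul0r mulr0.
Qed.

Let N_ip i (a : 'I_d) u : N i a u = ip (H [:: a]) (var i * H u).
Proof.
rewrite ip_rec (big_only1 ord_max) // => [|k kmax _].
  by rewrite [take _ _](take_size u) [drop _ _](drop_size u) eqxx nrm1 !mulr1.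
have -> : drop k u == [::] = false; last by rewrite mul0r mulr0.
rewrite -size_eq0 size_drop subn_eq0; apply: contraNF kmax => uk.
by rewrite -val_eqE eqn_leq uk -ltnS ltn_ord.
Qed.

Let N_conj i (a c : 'I_d) : N i a [:: c] = (N i c [:: a])^*.
Proof. by rewrite !N_ip -ip_conj ipXl. Qed.

Let N_size2 i (a : 'I_d) u : size u = 2 -> N i a u = (u == [:: i; a])%:R * nrm [:: i; a].
Proof.
move=> u2; rewrite N_ip -ipXl H_var.
(* x_i x_a is P_ia up to terms of degree at most 1, orthogonal to P_u. *)
have -> : var i * var a = H [:: i; a] - (H [:: i; a] - mon [:: i; a]).
  by rewrite subKr !mon_cons mon_nil mulr1.
rewrite ipDl // ipNl // orth eq_sym.
have -> : ip (H [:: i; a] - mon [:: i; a]) (H u) = 0.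
  apply: (mops_below phi_lin) => //; rewrite u2.
  by case: mV => /(_ [:: i; a]).
by rewrite subr0.
Qed.

Let N_size3 i (a : 'I_d) u : (2 < size u)%N -> N i a u = 0.
Proof.
move=> u3; rewrite N_ip -ipXl; apply: (mops_below phi_lin) => //.
apply: belowW u3 _; apply: belowX.
by case: mV => /(monic_below [:: a]).
Qed.

Let N_comm i (a c b : 'I_d) : N i a [:: c] * nrm [:: a; b] = N i a [:: c] * nrm [:: c; b].
Proof.
(* The two ways of letting x_i act in the inner product of P_xb and P_yb. *)
have L x y : ip (H [:: x; b]) (var i * H [:: y; b]) = N i x [:: y] * nrm [:: x; b].
  rewrite ip_rec !big_ord_recl big_ord0 /= eqseq_cons andbF !mul0r !mulr0 add0r.
  by rewrite eqxx mul1r !addr0.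
have conjM (x y : K) : (x * y)^* = x^* * y^* by exact: rmorphM.
rewrite -L ip_conj ipXl L conjM -N_conj; congr (_ * _).
by rewrite /nrm -ip_conj.
Qed.

Let T i : 'M[K]_d := \matrix_(j, k) N i j [:: k].
Let nrow := \row_(p < d * d) nrm [:: (mxtens_unindex p).1; (mxtens_unindex p).2].
Let C : 'M[K]_(d * d) := diag_mx (nrow - const_mx 1).

Let diag2E i j : 1 + diag2 C i j = nrm [:: i; j].
Proof. by rewrite /diag2 !mxE mxtens_indexK eqxx mulr1n subrKC. Qed.

Let NE i j : N i j = quad_series C T i j.
Proof.
apply/ncpsP => u; rewrite quad_series_coef diag2E.
have [u2|] := ltnP (size u) 2; last first.
  rewrite leq_eqVlt => /orP[/eqP/esym u2|u3].
    rewrite N_size2 // big1 ?addr0 => [|k _].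
      by case: u u2 => // k u _; rewrite mulr0 add0r mulrC.
    by case: u u2 => [|? [|]] //= *; rewrite eqseq_cons andbF mulr0.
  rewrite N_size3 // big1 => [|k _]; case: u u3 => [|? [|? [|? ?]]] //= _.
    by rewrite !eqseq_cons !andbF !mulr0 !addr0.
  by rewrite !eqseq_cons !andbF !mulr0.
case: u u2 => [|k [|//]] _.
  by rewrite N0 mulr1 mulr0 addr0 big1 ?addr0 // => k _; rewrite mulr0.
rewrite mulr0 add0r eqseq_cons andbF mulr0 addr0.
rewrite (big_only1 k) // => [|l lk _]; first by rewrite eqxx mulr1 mxE.
by rewrite eqseq_cons eq_sym (negPf lk) mulr0.
Qed.

Let admC : admissible C T.
Proof.
split=> [i|||i].
- apply/is_hermitianmxP/matrixP => a c; rewrite expr0 scale1r !mxE; exact: N_conj.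
- exact: diag_mx_is_diag.
- move=> v; have -> : 1%:M + C = diag_mx nrow.
    by rewrite -diag_const_mx -raddfD /= addrC subrK.
  rewrite mul_mx_diag mxE; apply: sumr_ge0 => p _; rewrite !mxE.
  rewrite mulrAC [_^* * _]mulrC -normCK mulr_ge0 ?exprn_ge0 //.
  exact: phi_ge0.
- rewrite mul_mx_diag mul_diag_mx; apply/matrixP => p q; rewrite !mxE.
  case: (mxtens_indexP p) => a b; case: (mxtens_indexP q) => c b'.
  rewrite !mxtens_indexK /=; have [<-|_] := eqVneq b b'; last first.
    by rewrite mulr0 mul0r mulr0.
  by rewrite mulr1 [RHS]mulrC !mulrBr -N_comm.
Qed.

(** The N_ij equal [quad_series] for the data read off from H, and V has linear
    part z, so that the substitution can be undone. *)
Lemma boolean_gf_mops_imp_pde : boolean_pde_cond.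
Proof.
exists C, T; split=> // i j; apply: (pssubst_inj V0 V1).
rewrite pssubst_quadratic // !VX -[LHS]/(N i j) NE /quad_series.
by under [in RHS]eq_bigr => k _ do rewrite VX.
Qed.

End FromMOPS.
End Necessity.

End GeneratingFunctions.

(** * Non-commutative polynomials as a word algebra *)

Section Polynomials.
Variables (K : numClosedFieldType) (d : nat).
Local Notation poly := (ncpoly K d).
Implicit Types (P Q : poly) (u v : seq 'I_d) (i j : 'I_d) (a : K).

Lemma mul_mon_malgC P (c : K) : P * c%:MP = c *: P.
Proof.
rewrite malgM_def fgmulgU malgZ_def; apply: eq_bigr => k _.
by rewrite mulm1 mulrC.
Qed.

Lemma malgC_comm P (c : K) : P * c%:MP = c%:MP * P.
Proof. by rewrite mul_mon_malgC mul_malgC. Qed.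

Lemma ncpoly_scaleA P (a b : K) : a *: (b *: P) = (a * b) *: P.
Proof. exact: scalerA. Qed.

Lemma ncpoly_scaleAl P Q (c : K) : (c *: P) * Q = c *: (P * Q).
Proof. exact/esym/scalerAl. Qed.

Lemma ncpoly_scaleAr P Q (c : K) : P * (c *: Q) = c *: (P * Q).
Proof. by rewrite -mul_malgC mulrA malgC_comm -mulrA mul_malgC. Qed.

Lemma ncmon_nil : ncmon K [::] = 1 :> poly.
Proof. by rewrite /ncmon big_nil. Qed.

Lemma ncmon_cons i u : ncmon K (i :: u) = ncX K i * ncmon K u.
Proof. by rewrite /ncmon big_cons. Qed.

Lemma ncmon_cat u v : ncmon K (u ++ v) = ncmon K u * ncmon K v.
Proof. by rewrite /ncmon big_cat. Qed.

Lemma ncmon1 i : ncmon K [:: i] = ncX K i.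
Proof. by rewrite ncmon_cons ncmon_nil mulr1. Qed.

Lemma scale_mon a u : a *: ncmon K u = << a *g FMonom u >>.
Proof. by rewrite ncmonE -mul_malgC malgM_def fgmulUU mulr1 mul1m. Qed.

(** The coercion from monomials to words, with its target type fixed. *)
Definition word (m : {fmonom 'I_d}) : seq 'I_d := m.

Lemma ncpoly_expand P : P = \sum_(m <- msupp P) P@_m *: ncmon K (word m).
Proof.
by rewrite {1}[P]monalgE; apply: eq_bigr => m _; rewrite scale_mon fmK.
Qed.

Let conjMP : {additive K -> poly} := (@malgC {fmonom 'I_d} K \o @Num.conj K)%FUN.

Let star_mmap P :
  star P = mmap conjMP (fun m : {fmonom 'I_d} => ncmon K (rev m)) P.
Proof. by apply: eq_bigr => m _; rewrite /= mul_malgC. Qed.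

Lemma starB P Q : star (P - Q) = star P - star Q.
Proof. by rewrite !star_mmap mmapB. Qed.

Lemma star0 : star (0 : poly) = 0.
Proof. by have := starB 0 0; rewrite !subrr. Qed.

Lemma starD P Q : star (P + Q) = star P + star Q.
Proof. by rewrite !star_mmap mmapD. Qed.

Lemma star_sum (J : Type) (r : seq J) (F : J -> poly) :
  star (\sum_(j <- r) F j) = \sum_(j <- r) star (F j).
Proof. exact: (big_morph _ starD star0). Qed.

Lemma starZmon a u : star (a *: ncmon K u) = a^* *: ncmon K (rev u).
Proof.
rewrite scale_mon.
by rewrite star_mmap mmapU /= mul_malgC.
Qed.

Local Opaque ncmon star.

Lemma starmon u : star (ncmon K u) = ncmon K (rev u).
Proof. by rewrite -[ncmon K u]scale1r starZmon rmorph1 scale1r. Qed.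

Lemma starZ a P : star (a *: P) = a^* *: star P.
Proof.
rewrite {1}(ncpoly_expand P) scaler_sumr star_sum [in RHS](ncpoly_expand P) star_sum.
rewrite scaler_sumr; apply: eq_bigr => m _.
transitivity ((a * P@_m)^* *: ncmon K (rev (word m))).
  by rewrite scalerA; apply: starZmon.
by rewrite rmorphM -ncpoly_scaleA; congr (_ *: _); apply/esym/starZmon.
Qed.

Let starM_mon a u v : star (ncmon K u * (a *: ncmon K v)) =
  star (a *: ncmon K v) * star (ncmon K u).
Proof.
have -> : ncmon K u * (a *: ncmon K v) = a *: ncmon K (u ++ v).
  by rewrite ncpoly_scaleAr ncmon_cat.
transitivity (a^* *: ncmon K (rev (u ++ v))); first exact: starZmon.
rewrite rev_cat ncmon_cat.
transitivity ((a^* *: ncmon K (rev v)) * ncmon K (rev u)).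
  exact/esym/ncpoly_scaleAl.
by congr (_ * _); apply/esym; [exact: starZmon | exact: starmon].
Qed.

Lemma starM P Q : star (P * Q) = star Q * star P.
Proof.
have monM u : star (ncmon K u * Q) = star Q * star (ncmon K u).
  rewrite {1}(ncpoly_expand Q) mulr_sumr star_sum [in RHS](ncpoly_expand Q).
  by rewrite star_sum mulr_suml; apply: eq_bigr => m _; apply: starM_mon.
have -> : P * Q = \sum_(m <- msupp P) P@_m *: (ncmon K (word m) * Q).
  rewrite {1}(ncpoly_expand P) mulr_suml.
  by apply: eq_bigr => m _; apply: ncpoly_scaleAl.
rewrite star_sum [in RHS](ncpoly_expand P) star_sum mulr_sumr.
apply: eq_bigr => m _; transitivity ((P@_m)^* *: star (ncmon K (word m) * Q)).
  exact: starZ.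
by rewrite monM -ncpoly_scaleAr; congr (_ * _); apply/esym/starZ.
Qed.

Lemma starX i : star (ncX K i) = ncX K i.
Proof. by rewrite -ncmon1 starmon. Qed.

Definition lowdeg n P := forall m, m \in msupp P -> (size (m : seq 'I_d) < n)%N.

Lemma lowdeg0 n : lowdeg n 0.
Proof. by move=> m; rewrite msupp0 in_fset0. Qed.

Lemma lowdegD n P Q : lowdeg n P -> lowdeg n Q -> lowdeg n (P + Q).
Proof.
by move=> nP nQ m /(fsubsetP (msuppD_le _ _)); rewrite in_fsetU => /orP[/nP|/nQ].
Qed.

Lemma lowdegZ n a P : lowdeg n P -> lowdeg n (a *: P).
Proof. by move=> nP m /(fsubsetP (msuppZ_le _ _))/nP. Qed.

Lemma lowdegW n n' P : (n <= n')%N -> lowdeg n P -> lowdeg n' P.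
Proof. by move=> nn nP m /nP/leq_trans; apply. Qed.

Lemma lowdeg_mon u : lowdeg (size u).+1 (ncmon K u).
Proof. by move=> m; rewrite ncmonE msuppU1 in_fset1 => /eqP->. Qed.

Lemma lowdegXM n i P : lowdeg n P -> lowdeg n.+1 (ncX K i * P).
Proof.
move=> nP m /msuppM_le[k1 [k2 []]]; rewrite msuppU1 in_fset1 => /eqP-> /nP k2n ->.
by rewrite fmM fmU.
Qed.

Lemma lowdeg_exists P : exists n, lowdeg n P.
Proof.
exists (\max_(m <- msupp P) (size (m : seq 'I_d)).+1)%N => m mP.
exact: (leq_bigmax_seq (P := predT) (F := fun m => (size (word m)).+1) m mP).
Qed.

Section Leading.
Variable B : seq 'I_d -> poly.
Hypothesis leadB : forall u, lowdeg (size u) (B u - ncmon K u).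

(** A word is the member of the family with that leading term up to
    lower-order terms, which are handled by induction on the degree. *)
Lemma monic_family_ind (S : poly -> Prop) n :
  S 0 -> (forall P Q, S P -> S Q -> S (P + Q)) -> (forall a P, S P -> S (a *: P)) ->
  (forall u, (size u < n)%N -> S (B u)) ->
  forall P, lowdeg n P -> S P.
Proof.
move=> S0 SD SZ; elim: n => [|n IH] SB P nP.
  have -> : P = 0.
    by rewrite (ncpoly_expand P) big_seq big1 // => m /nP.
  exact: S0.
rewrite (ncpoly_expand P) big_seq; apply: big_ind => // m /nP; rewrite ltnS => mn.
apply: (SZ); rewrite -[ncmon K m](subKr (B m)); apply: (SD); first exact: SB.
rewrite -scaleN1r; apply: (SZ); apply: IH => [u un|]; first by apply: SB; rewrite ltnW.
exact: (lowdegW mn (@leadB m)).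
Qed.

End Leading.

Lemma starK P : star (star P) = P.
Proof.
have starP : star P = \sum_(m <- msupp P) star (P@_m *: ncmon K (word m)).
  by rewrite [in LHS](ncpoly_expand P) star_sum.
rewrite starP star_sum [RHS]ncpoly_expand.
apply: eq_bigr => m _.
transitivity (star ((P@_m)^* *: ncmon K (rev (word m)))).
  by congr star; apply: starZmon.
transitivity ((P@_m)^*^* *: ncmon K (rev (rev (word m)))); first exact: starZmon.
by rewrite conjCK revK.
Qed.


End Polynomials.

(** * Cumulants, Fock space and the equivalences *)

Section Cumulants.
Variables (K : numClosedFieldType) (d : nat).
Local Notation poly := (ncpoly K d).
Implicit Types (u v : seq 'I_d) (kappa : seq 'I_d -> K) (m f : ncps d K).

(** The last block of an interval partition contributes the factor kappa of a
    final segment. *)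
Lemma boolean_moment_series kappa m :
  kappa [::] = 0 -> (forall u, m u = interval_sum kappa u) -> m [::] = 1 ->
  m = 1 + m * NCPS kappa.
Proof.
move=> k0 mE m1; apply/ncpsP => u; rewrite pscoefD pscoef1.
have [->|u0] := eqVneq u [::]; first by rewrite pscoefM0 /= k0 mulr0 addr0 m1.
rewrite mE interval_sum_rec // add0r pscoefM big_ord_recr /= drop_size k0 mulr0 addr0.
by apply: eq_bigr => j _; rewrite -mE.
Qed.

(** With w_i = m z_i and R_v the series of coefficients kappa(v u), the identity
    R_v(w) = kappa(v) + sum_i m z_i R_(v i)(w) is the recursion along the last
    block: v is the part of the block already read, m the gap before its next
    letter. *)
Lemma free_moment_series kappa m :
  kappa [::] = 0 -> (forall u, m u = noncrossing_sum kappa u) -> m [::] = 1 ->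
  m = 1 + pssubst (NCPS kappa) (fun i => m * psX K i).
Proof.
move=> k0 mE m1; pose w i := m * psX K i.
have w0 i : w i [::] = 0 by rewrite pscoefM0 psX_coef0 mulr0.
(* R v is the iterated derivative of the cumulant series along v. *)
pose R v := NCPS (fun u => kappa (v ++ u)).
apply/ncpsP => u; rewrite pscoefD pscoef1.
have [->|u0] := eqVneq u [::]; first by rewrite pssubst_coef0 //= k0 addr0 m1.
rewrite add0r mE; apply: (noncrossing_sum_rec (X := fun v u => pssubst (R v) w u)) => //.
  by move=> v; rewrite pssubst_coef0 //= cats0.
move=> v {}u x0 {}u0; rewrite pssubst_split // pscoefD.
have -> : psC d (R v [::]) u = 0 by rewrite /= (negPf u0).
have -> : \sum_i w i * pssubst (psD i (R v)) w =
    m * \sum_i psX K i * pssubst (R (rcons v i)) w.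
  rewrite mulr_sumr; apply: eq_bigr => i _; rewrite -mulrA; congr (_ * (_ * _)).
  by congr pssubst; apply/ncpsP => t; rewrite /= cat_rcons.
rewrite add0r pscoefM big_ord_recr.
have -> : (\sum_i psX K i * pssubst (R (rcons v i)) w) (drop (@ord_max (size u)) u) = 0.
  by rewrite [drop _ _](drop_size u) coef_sumX0.
rewrite mulr0; apply: etrans (addr0 _) _; apply: eq_bigr => j _.
rewrite -mE; congr (_ * _); rewrite [drop _ u](_ : _ = nth x0 u j :: drop j.+1 u).
  by rewrite coef_sumX.
by rewrite /= (drop_nth x0).
Qed.

End Cumulants.

Section LinearExtension.
Variables (K : numClosedFieldType) (I : choiceType) (V : lmodType K).
Implicit Types (f : I -> V) (x y : {malg K[I]}).

(** Both the operators and the polynomial calculus on the Fock space are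
    linear extensions of this form. *)
Definition lin_ext f x : V := \sum_(k <- msupp x) x@_k *: f k.

Lemma lin_extE f x (E : {fset I}) :
  (msupp x `<=` E)%fset -> lin_ext f x = \sum_(k <- E) x@_k *: f k.
Proof.
move=> sE; apply: big_fset_incl sE _ => k _ kx.
by rewrite mcoeff_outdom // scale0r.
Qed.

Lemma lin_extP f a x y : lin_ext f (a *: x + y) = a *: lin_ext f x + lin_ext f y.
Proof.
pose E := (msupp (a *: x + y) `|` (msupp x `|` msupp y))%fset.
rewrite !(@lin_extE _ _ E) ?scaler_sumr -?big_split /=; last 3 first.
- by apply/fsubsetP => k kx; rewrite !in_fsetU kx !orbT.
- by apply/fsubsetP => k kx; rewrite !in_fsetU kx !orbT.
- by apply/fsubsetP => k kx; rewrite !in_fsetU kx.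
by apply: eq_bigr => k _; rewrite mcoeffD mcoeffZ scalerDl scalerA.
Qed.

Lemma lin_extU f k : lin_ext f << k >> = f k.
Proof. by rewrite /lin_ext msuppU oner_eq0 big_seq_fset1 mcoeffUU scale1r. Qed.

End LinearExtension.

(** The recursion for the P_u is mapped to the recursion that defines the
    basis vectors: each x_i acts on P_u as L_i does on b_u. *)
Lemma monic_recursion_image (K : numClosedFieldType) (d : nat)
    (W : word_algebra K d) (V : lmodType K) (f : W -> V) (L : 'I_d -> V -> V)
    (b : seq 'I_d -> V) (C : 'M[K]_(d * d)) (T : 'I_d -> 'M[K]_d)
    (P : seq 'I_d -> W) :
  (forall a p q, f (cst W a * p + q) = a *: f p + f q) ->
  (forall i p, f (var W i * p) = L i (f p)) ->
  f 1 = b [::] -> (forall i, L i (b [::]) = b [:: i]) ->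
  (forall i j u, L i (b (j :: u)) = b [:: i, j & u] + \sum_k T i k j *: b (k :: u)
                                  + ((i == j)%:R * lowering C i u) *: b u) ->
  monic_recursion C T P -> forall u, f (P u) = b u.
Proof.
move=> f_lin fX f1 L1 Lrec [P0 P1 Prec].
have fD p q : f (p + q) = f p + f q.
  by have := f_lin 1 p q; rewrite rmorph1 mul1r scale1r.
have f0 : f 0 = 0 by apply: (addrI (f 0)); rewrite -fD !addr0.
have fC a p : f (cst W a * p) = a *: f p.
  by rewrite -[_ * p]addr0 f_lin f0 addr0.
have f_sum (F : 'I_d -> W) : f (\sum_k F k) = \sum_k f (F k).
  exact: (big_morph f fD f0).
move=> u; have [n] := ubnP (size u); elim: n u => // n IH [|i [|j u]] un.
- by rewrite P0.
- by rewrite -P1 fX P0 f1.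
have IHj k : f (P (k :: u)) = b (k :: u) by apply: IH.
have IHu : f (P u) = b u by apply: IH; exact: (@ltnW (size u).+1 n un).
have := congr1 f (Prec i j u); rewrite fX IHj Lrec !fD f_sum fC IHu.
by under [in RHS]eq_bigr => k _ do rewrite fC IHj; move=> /addIr/addIr.
Qed.

Section Fock.
Variables (K : numClosedFieldType) (d : nat).
Variables (C : 'M[K]_(d * d)) (T : 'I_d -> 'M[K]_d).
Local Notation fock := {malg K[seq 'I_d]}.
Local Notation poly := (ncpoly K d).

Lemma fockXP i a (x y : fock) :
  fockX C T i (a *: x + y) = a *: fockX C T i x + fockX C T i y.
Proof. exact: lin_extP. Qed.

Lemma fockXU i u : fockX C T i << u >> = fockX_basis C T i u.
Proof. exact: lin_extU. Qed.

Lemma fock_evalP a (P Q : poly) (x : fock) :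
  fock_eval C T (a *: P + Q) x = a *: fock_eval C T P x + fock_eval C T Q x.
Proof. exact: lin_extP. Qed.

Lemma fock_eval_mon u (x : fock) : fock_eval C T (ncmon K u) x = foldr (fockX C T) x u.
Proof. by rewrite ncmonE; apply: lin_extU. Qed.

Lemma fock_eval0 (x : fock) : fock_eval C T 0 x = 0.
Proof. by rewrite /fock_eval msupp0 big_seq_fset0. Qed.

Lemma fock_evalX i (P : poly) (x : fock) :
  fock_eval C T (ncX K i * P) x = fockX C T i (fock_eval C T P x).
Proof.
have fockX0 : fockX C T i 0 = 0 by rewrite /fockX msupp0 big_seq_fset0.
have scaleX a u : ncX K i * (a *: ncmon K u) = a *: ncmon K (i :: u).
  by rewrite ncmon_cons; apply: ncpoly_scaleAr.
suff H (s : seq {fmonom 'I_d}) (c : {fmonom 'I_d} -> K) :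
    fock_eval C T (ncX K i * \sum_(k <- s) c k *: ncmon K (word k)) x =
    fockX C T i (fock_eval C T (\sum_(k <- s) c k *: ncmon K (word k)) x).
  by rewrite (ncpoly_expand P); apply: H.
elim: s => [|k s IH]; first by rewrite !big_nil mulr0 !fock_eval0 fockX0.
rewrite !big_cons mulrDr scaleX.
set Q := \sum_(j <- s) _ in IH *.
transitivity (c k *: fock_eval C T (ncmon K (i :: word k)) x +
              fock_eval C T (ncX K i * Q) x); first exact: fock_evalP.
transitivity (fockX C T i (c k *: fock_eval C T (ncmon K (word k)) x +
                           fock_eval C T Q x)).
  by rewrite fockXP IH !fock_eval_mon.
by congr fockX; apply/esym; exact: fock_evalP.
Qed.

End Fock.

Section Concrete.
Variables (K : numClosedFieldType) (d : nat).
Local Notation poly := (ncpoly K d).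

Lemma starC (a : K) : star (a%:MP : poly) = (a^*)%:MP.
Proof.
rewrite -[a%:MP]mulr1 mul_malgC -ncmon_nil; apply: etrans (starZmon _ _) _.
by rewrite /rev /= ncmon_nil -mul_malgC mulr1.
Qed.

Lemma lowdegC n (a : K) (P : poly) : lowdeg n P -> lowdeg n (a%:MP * P).
Proof. by move=> nP; rewrite mul_malgC; apply: lowdegZ. Qed.

Lemma monic_family_indC (B : seq 'I_d -> poly) (S : poly -> Prop) n :
    (forall u, lowdeg (size u) (B u - \prod_(i <- u) ncX K i)) ->
    S 0 -> (forall p q, S p -> S q -> S (p + q)) ->
    (forall a p, S p -> S (a%:MP * p)) ->
    (forall u, (size u < n)%N -> S (B u)) ->
    forall p, lowdeg n p -> S p.
Proof.
move=> lB S0 SD SC; apply: monic_family_ind => // a P SP.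
by rewrite -mul_malgC; apply: SC.
Qed.

Definition ncpoly_word_algebra : word_algebra K d :=
  @WordAlgebra K d poly (@malgC {fmonom 'I_d} K) (@ncX K d) (@star K d) (@lowdeg K d)
    (fun a p => esym (malgC_comm p a)) (@starD K d) (@starM K d) starC (@starX K d)
    (@starK K d) (@lowdegD K d) lowdegC (@lowdegXM K d) (@lowdegW K d)
    (@lowdeg_exists K d) (@lowdeg0 K d) (@lowdeg_mon K d) monic_family_indC.


Variable phi : {scalar poly}.
Implicit Types (C : 'M[K]_(d * d)) (T : 'I_d -> 'M[K]_d).
Local Notation W := ncpoly_word_algebra.

Lemma phi_ncpoly_lin (a : K) (p q : W) : phi (cst W a * p + q) = a * phi p + phi q.
Proof. by rewrite [cst W a * p](mul_malgC a (p : poly)); apply: linearP. Qed.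

Lemma recursion_scale C T (P : seq 'I_d -> poly) :
  monic_recursion C T (P : seq 'I_d -> W) <->
  [/\ P [::] = 1,
        forall i, ncX K i = P [:: i],
        forall i j, ncX K i * P [:: j] =
          P [:: i; j] + \sum_k T i k j *: P [:: k] + (i == j)%:R &
        forall i j v w, let u := v :: w in
          ncX K i * P (j :: u) =
          P [:: i, j & u] + \sum_k T i k j *: P (k :: u)
          + ((i == j)%:R * (1 + diag2 C i v)) *: P u].
Proof.
have sumE i j u : \sum_k T i k j *: P (k :: u) =
    \sum_k (T i k j)%:MP * P (k :: u).
  by apply: eq_bigr => k _; apply/esym/mul_malgC.
split=> [[P0 P1 Prec]|[P0 P1 P2 Prec]]; split=> //.
- by move=> i; rewrite -[RHS]P1 P0 mulr1.
- move=> i j; rewrite sumE; apply: etrans (Prec i j [::]) _; congr (_ + _).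
  by rewrite P0 mulr1 mulr1 rmorph_nat.
- move=> i j v w u; rewrite sumE; apply: etrans (Prec i j u) _; congr (_ + _).
  exact: mul_malgC.
- by move=> i; rewrite P0 mulr1; apply: P1.
move=> i j [|v w].
  apply: etrans (P2 i j) _; rewrite sumE; congr (_ + _).
  by rewrite P0 mulr1 mulr1 rmorph_nat.
apply: etrans (Prec i j v w) _; rewrite sumE; congr (_ + _).
exact/esym/mul_malgC.
Qed.

Lemma cond_F4_recursion : cond_F4 phi <-> recursion_cond (W := W) phi.
Proof.
split=> -[C [T [adm [P]]]].
  case=> P0 Pphi P1 P2 Prec; exists C, T; split=> //; exists P; split=> //.
  exact/recursion_scale.
by case=> /recursion_scale[P0 P1 P2 Prec] Pphi; exists C, T; split=> //; exists P.
Qed.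

Lemma fock_state_recursion C T (P : seq 'I_d -> W) :
  monic_recursion C T P -> forall u, fock_state C T (P u) = (u == [::])%:R.
Proof.
move=> Prec u; pose f (Q : W) := fock_eval C T Q << [::] >>.
suff fP : f (P u) = << u >> by rewrite /fock_state -/(f _) fP mcoeffU.
apply: (monic_recursion_image (L := fockX C T) (b := fun u => << u >>) _ _ _ _ _ Prec).
- move=> a p q; rewrite [cst W a * p](mul_malgC a (p : poly)); exact: fock_evalP.
- move=> i p; exact: fock_evalX.
- by rewrite /f -ncmon_nil fock_eval_mon.
- by move=> i; apply: fockXU.
move=> i j [|l v]; first last.
  (* C_jl in the Fock operator, C_il in the recursion: delta_ij makes them agree. *)
  have -> : (i == j)%:R * lowering C i (l :: v) = (i == j)%:R * (1 + diag2 C j l).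
    by case: eqP => [->|_] //; rewrite !mul0r.
  exact: (fockXU C T i [:: j, l & v]).
rewrite [lowering _ _ _]/(1) mulr1.
exact: (fockXU C T i [:: j]).
Qed.

Lemma fock_state_lin C T (a : K) (p q : W) :
  fock_state C T (cst W a * p + q) = a * fock_state C T p + fock_state C T q.
Proof.
rewrite [cst W a * p](mul_malgC a (p : poly)) /fock_state.
by rewrite (fock_evalP C T a p q) mcoeffD mcoeffZ.
Qed.

Lemma cond_F2_recursion : phi 1 = 1 -> cond_F2 phi <-> recursion_cond (W := W) phi.
Proof.
move=> phi1; split=> [[C [T [adm phiE]]]|[C [T [adm [P [Prec Pphi]]]]]].
  exists C, T; split=> //; exists (rec_poly W C T); split; first exact: rec_polyP.
  move=> u u0; rewrite phiE (fock_state_recursion (@rec_polyP _ _ W C T)).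
  by rewrite (negPf u0).
exists C, T; split=> //.
apply: (phi_eq phi_ncpoly_lin (fock_state_lin C T) (monic_recursion_monic Prec)) => u.
rewrite (fock_state_recursion Prec); have [->|/Pphi//] := eqVneq u [::].
by case: Prec => -> _ _.
Qed.

Lemma cumulant_moments (S : forall n, pred {set {set 'I_n}})
    (S' : forall n, pred {set {set 'I_n}}) (kappa : {scalar poly}) :
  (forall n p, S n p = partition p setT && S' n p) -> is_cumulant S phi kappa ->
  forall u, phi (ncmon K u) =
    partition_sum (fun v => kappa (ncmon K v)) S' [set: 'I_(size u)].
Proof.
by move=> SE [_ H] u; apply: etrans (H u) _; apply: eq_bigl => p; rewrite SE.
Qed.

Lemma cumulant_gfE (kappa : {scalar poly}) : kappa 1 = 0 ->
  cumulant_gf kappa = NCPS (fun u => kappa (ncmon K u)).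
Proof. by move=> k1; apply/ncpsP => -[|i u] //=; rewrite ncmon_nil. Qed.

Lemma tfae_conditions (eta rho : {scalar poly}) :
  is_state phi ->
  (forall i, phi (ncX K i) = 0) ->
  (forall i j, phi (ncX K i * ncX K j) = (i == j)%:R) ->
  is_boolean_cumulant phi eta ->
  is_free_cumulant phi rho ->
  [<-> cond_B1 phi eta; cond_B2 eta; cond_F1 phi rho; cond_F2 phi;
       cond_F3 rho; cond_F4 phi].
Proof.
move=> [phi1 phi_star phi_ge0] mean0 cov1 etaP rhoP.
have eta1 : eta 1 = 0 by case: etaP.
have rho1 : rho 1 = 0 by case: rhoP.
pose e := cumulant_gf eta; pose r := cumulant_gf rho.
pose m := moments (W := W) phi.
have m0 : m [::] = 1 := moments0 (W := W) phi1.
have mE : m = 1 + m * e.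
  rewrite /e cumulant_gfE //; apply: boolean_moment_series => //.
    by rewrite ncmon_nil.
  exact: (cumulant_moments (S' := convex_blocks) _ etaP).
have mR : m = 1 + pssubst r (fun i => m * psX K i).
  rewrite /r cumulant_gfE //; apply: free_moment_series => //.
    by rewrite ncmon_nil.
  exact: (cumulant_moments (S' := noncrossing) _ rhoP).
have e0 : e [::] = 0 by [].
have r0 : r [::] = 0 by [].
have lin := phi_ncpoly_lin.
have B1_B2 : cond_B1 phi eta -> cond_B2 eta.
  move=> [V [V0 VX mV]].
  exact: (boolean_gf_mops_imp_pde lin phi1 e0 mE mean0 cov1 phi_star phi_ge0 V0 VX mV).
have B2_F4 : cond_B2 eta -> cond_F4 phi.
  move=> B2; apply/cond_F4_recursion.
  exact: (boolean_pde_imp_recursion lin phi1 e0 mE mean0 B2).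
have F4_gf : cond_F4 phi -> resolvent_cond (W := W) phi e.
  move=> /cond_F4_recursion F4.
  exact: (recursion_boolean_gf lin phi1 mE F4).
have gf_B1 : resolvent_cond (W := W) phi e -> cond_B1 phi eta.
  by move/(boolean_gf_condP lin phi1 e0 mE mean0 cov1).
have F1_gf : cond_F1 phi rho <-> resolvent_cond (W := W) phi e.
  exact: (free_gf_condP phi1 r0 mE mR).
have B2_F3 : cond_B2 eta <-> cond_F3 rho.
  exact: (boolean_free_pde_condP phi1 e0 r0 mE mR mean0).
have F2_F4 : cond_F2 phi <-> cond_F4 phi.
  exact: (iff_trans (cond_F2_recursion phi1) (iff_sym cond_F4_recursion)).
have F4_B2 F4 : cond_B2 eta := B1_B2 (gf_B1 (F4_gf F4)).
tfae.
- exact: B1_B2.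
- by move=> B2; exact: (proj2 F1_gf (F4_gf (B2_F4 B2))).
- by move=> F1; exact: (proj2 F2_F4 (B2_F4 (B1_B2 (gf_B1 (proj1 F1_gf F1))))).
- by move=> F2; exact: (proj1 B2_F3 (F4_B2 (proj1 F2_F4 F2))).
- by move=> F3; exact: (B2_F4 (proj2 B2_F3 F3)).
- by move=> F4; exact: (gf_B1 (F4_gf F4)).
Qed.

End Concrete.

Theorem proposition7 (R : realType) (d : nat)
    (phi eta rho : {scalar ncpoly R[i] d}) :
  is_state phi ->
  (exists P, is_MOPS phi P) ->
  (forall i, phi (ncX _ i) = 0) ->
  (forall i j, phi (ncX _ i * ncX _ j) = (i == j)%:R) ->
  is_boolean_cumulant phi eta ->
  is_free_cumulant phi rho ->
  [<-> cond_B1 phi eta;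
       cond_B2 eta;
       cond_F1 phi rho;
       cond_F2 phi;
       cond_F3 rho;
       cond_F4 phi].
Proof.
by move=> st _ mean0 cov1; apply: tfae_conditions.
Qed.
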